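(* Let $K$ be a compact space. The following conditions are equivalent: (i) $K$ is a Corson compact space. (ii) Every continuous image of $K$ has a retractional skeleton.
   Context: All compact spaces are Hausdorff; a continuous image of $K$ is a compact Hausdorff space $L$ admitting a continuous surjection $K\to L$. Corson compact: for a set $\kappa$ let $\Sigma(\kappa)=\{x\in\mathbb R^\kappa: \{\gamma: x(\gamma)\neq 0\}\text{ is countable}\}$. A compact space $K$ is Corson if there is a homeomorphic embedding $h:K\to[0,1]^\kappa$ for some $\kappa$ with $h[K]\subset\Sigma(\kappa)$. Retractional skeleton: a retractional skeleton ($r$-skeleton) in a compact space $K$ is a family of (continuous) retractions $\{r_s\}_{s\in\Gamma}$ of $K$, indexed by an up-directed partially ordered set $\Gamma$, such that (i) for every $x\in K$, $x=\lim_{s\in\Gamma}r_s(x)$, and $r_s[K]$ is metrizable for each $s\in\Gamma$; (ii) $s\le t\Rightarrow r_s=r_s\circ r_t=r_t\circ r_s$; (iii) given $s_0<s_1<\cdots$ in $\Gamma$, $t=\sup_n s_n$ exists in $\Gamma$ and $r_t(x)=\lim_{n\to\infty}r_{s_n}(x)$ for every $x\in K$. *)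

(* Defs.v *)
From HB Require Import structures.
From mathcomp Require Import all_boot all_order all_algebra.
From mathcomp Require Import all_classical all_reals all_analysis.

Set Implicit Arguments.
Unset Strict Implicit.
Unset Printing Implicit Defensive.

Import Order.TTheory GRing.Theory Num.Theory.
Import numFieldNormedType.Exports.

Local Open Scope classical_set_scope.
Local Open Scope ring_scope.

Definition compact_hausdorff (K : topologicalType) : Prop :=
  compact [set: K] /\ hausdorff_space K.

Definition continuous_image (K L : topologicalType) : Prop :=
  compact_hausdorff L /\
  exists f : K -> L, continuous f /\ set_surj [set: K] [set: L] f.

(* The last clause says that [f] is open as a map onto its range, the range
   carrying the subspace topology. *)
Definition embedding (S T : topologicalType) (f : S -> T) : Prop :=
  [/\ injective f,
      continuous f &
      forall U : set S, open U ->
        exists2 V : set T, open V & f @` U = range f `&` V].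

Definition Sigma_product (R : realType) (kappa : Type) : set (kappa -> R) :=
  [set x | countable [set g | x g != 0]].
Arguments Sigma_product R kappa : clear implicits.

(* [0,1]^kappa is viewed as a subspace of the product space R^kappa. *)
Definition corson (R : realType) (K : topologicalType) : Prop :=
  exists (kappa : Type) (h : K -> {ptws kappa -> R}),
    [/\ embedding h,
        forall x g, h x g \in `[0, 1] &
        range h `<=` Sigma_product R kappa].

Definition metrizable (R : realType) (T : topologicalType) : Prop :=
  exists d : T -> T -> R,
    [/\ forall x y, 0 <= d x y,
        forall x y, d x y = 0 <-> x = y,
        forall x y, d x y = d y x,
        forall x y z, d x z <= d x y + d y z &
        forall x : T, nbhs x =
          filter_from [set e : R | 0 < e] (fun e => [set y | d x y < e])].

(* By convention an up-directed set is nonempty. *)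
Definition up_directed (d : Order.disp_t) (G : porderType d) : Prop :=
  inhabited G /\ forall s t : G, exists u : G, (s <= u)%O /\ (t <= u)%O.

(* The filter of tails: a net [x : G -> T] converges to [l] when
   [x s @[s --> tails G] --> l]. *)
Definition tails (d : Order.disp_t) (G : porderType d) : set_system G :=
  filter_from [set: G] (fun s => [set t | (s <= t)%O]).
Arguments tails {d} G.

Definition retraction (K : topologicalType) (r : K -> K) : Prop :=
  continuous r /\ forall x, r (r x) = r x.

Record r_skeleton (R : realType) (K : topologicalType) (d : Order.disp_t)
    (G : porderType d) (r : G -> K -> K) : Prop := RSkeleton {
  rsk_directed : up_directed G;
  rsk_retraction : forall s, retraction (r s);
  rsk_lim : forall x : K, r s x @[s --> tails G] --> x;
  (* [set_type A] carries the subspace topology of [A] *)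
  rsk_metrizable : forall s, metrizable R (set_type (range (r s)));
  rsk_commute : forall s t, (s <= t)%O ->
    r s = r s \o r t /\ r s = r t \o r s;
  rsk_sup : forall s : nat -> G, (forall n, (s n < s n.+1)%O) ->
    exists2 t : G, supremums (range s) t &
      forall x : K, r (s n) x @[n --> \oo] --> r t x }.

Definition has_r_skeleton (R : realType) (K : topologicalType) : Prop :=
  exists (d : Order.disp_t) (G : porderType d) (r : G -> K -> K),
    r_skeleton R r.

(* Main.v *)
Require Import Defs.
From HB Require Import structures.
From mathcomp Require Import all_boot all_order all_algebra.
From mathcomp Require Import all_classical all_reals all_analysis.
From mathcomp Require Import lra.

Set Implicit Arguments.
Unset Strict Implicit.
Unset Printing Implicit Defensive.

Import Order.TTheory GRing.Theory Num.Theory.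
Import numFieldNormedType.Exports.

Local Open Scope classical_set_scope.
Local Open Scope ring_scope.

(** Write [D] for the set of points fixed by some retraction of a skeleton (the
set induced by the skeleton, [skeleton_core] below). It is dense and has the
Fréchet-Urysohn property, in the strong form [skeleton_frechet_urysohn]: if a
point [x], in [D] or not, lies in the closure of [M `<=` D], then some sequence
of [M] converges to some [r t x].

From images to Corson. Let every continuous image of [K] have a skeleton; in
particular [K] has one. First, [D] is all of [K] ([outside_core_absurd]).
Otherwise fix [b] outside [D]. Along a chain of indices of length omega_1 there
are disjoint pairs [x a], [x' a] (a < omega_1) of non-isolated points of the
form [r s b], which accumulate at the end of the chain at a point [b'] outside
[D]; together they lie on a copy of the ordinal segment [0, omega_1]. Glue each
pair to one point, and glue [b'] to a point [c] that precedes the chain. The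
result is a compact Hausdorff image [L] of [K]. A point of [L] near which [L]
is the union of two closed sets that meet only there, the point being a limit
of each difference of the two, belongs to the induced set of any skeleton of
[L] ([skeleton_forcing]): the retractions would otherwise move this point into one
of the two sets, and closing off on the other one gives a contradiction. So
all glued points are in the induced set of [L], and by the Fréchet-Urysohn
property the image of [b'] is the limit of a sequence of images of points
[x a]. This is impossible, as the copy of omega_1 has no countable cofinal
subset.

Secondly, a skeleton with [D = K] gives an embedding into a Sigma-product
([full_skeleton_corson]). Countable tightness turns every directed set [T] of
indices into a retraction [dretract r T], the limit of the [r s], [s] in [T].
A well-order of the indices exhausts them by an increasing continuous chain of
directed sets, each generated by an initial segment. By induction on the length
of such well-orders ([coordinatized_initial]) the retractions of the chain have
point-countable separating families of functions [f], and the differences [f (r_(v+1) x) - f (r_v x)] form such a family for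
the union: for a fixed [x] only countably many steps of the chain move [x]
([countable_jumps]).

From Corson to images. Let [h : K -> R^kappa] be the embedding and [q : K -> L]
the surjection. A countable set [A] of coordinates is [admissible] if
restricting coordinates to [A] maps [K] to itself and respects the kernel of
[q]. Restriction then descends to a retraction of [L]. Closing off under
countably many choices shows that admissible sets are cofinal among the
countable ones ([admissible_cofinal]), and they are closed under increasing
unions ([admissible_bigcup]), so that they index a skeleton of [L]. *)

(** * Compact Hausdorff spaces and pointwise convergence *)

Section CompactHausdorff.
Variable K : topologicalType.
Hypothesis hK : compact_hausdorff K.

Lemma cluster_exists (F : set_system K) :
  ProperFilter F -> exists x, cluster F x.
Proof. by move=> FF; have [x [_ ?]] := hK.1 F FF filterT; exists x. Qed.

Lemma cluster_unique_cvg (F : set_system K) x : ProperFilter F ->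
  (forall y, cluster F y -> y = x) -> F --> x.
Proof.
move=> FF h; apply: (@compact_cluster_set1 _ x F setT hK.2 hK.1) => //;
  try exact: filterT.
have [y cy] := cluster_exists FF.
by apply/seteqP; split=> [z /h ->//|_ ->]; rewrite -(h _ cy).
Qed.

End CompactHausdorff.

Lemma cvg_cluster_eq (T : topologicalType) (F : set_system T) x y :
  hausdorff_space T -> F --> x -> cluster F y -> y = x.
Proof. by move=> hT Fx /(cvg_cluster Fx) /hT. Qed.

Lemma closed_eqfun (T U : topologicalType) (f g : T -> U) : hausdorff_space U ->
  continuous f -> continuous g -> closed [set x | f x = g x].
Proof.
move=> hU fc gc x cx; apply: hU => A B Afx Bgx.
have /cx [z [/= fgz [Az Bz]]] : nbhs x (f @^-1` A `&` g @^-1` B).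
  by apply: filterI; [exact: fc|exact: gc].
by exists (f z); split => //; rewrite fgz.
Qed.

Lemma cluster_closed (T : topologicalType) (F : set_system T) (C : set T) x :
  closed C -> F C -> cluster F x -> C x.
Proof. by move=> Cc FC; rewrite clusterE => /(_ _ FC) /Cc. Qed.

Lemma cluster_map (T U : topologicalType) (f : T -> U) (F : set_system T) x :
  {for x, continuous f} -> cluster F x -> cluster (f @ F) (f x).
Proof.
move=> fx cx A B FA Bfx.
by have [z [Az Bz]] := cx _ _ FA (fx _ Bfx); exists (f z).
Qed.

Lemma closure_exists (T : topologicalType) (A U : set T) x :
  closure A x -> nbhs x U -> exists2 z, A z & U z.
Proof. by move=> cA /cA [z [Az Uz]]; exists z. Qed.

Lemma compact_closed_map (S T : topologicalType) (f : S -> T) (C : set S) :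
  compact [set: S] -> hausdorff_space T -> continuous f -> closed C ->
  closed (f @` C).
Proof.
move=> cS hT fc Cc; apply: compact_closed hT _; apply: continuous_compact.
  exact: continuous_subspaceT.
exact: (subclosed_compact Cc cS).
Qed.

Lemma hausdorff_closed_point (T : topologicalType) (x : T) :
  hausdorff_space T -> closed [set x].
Proof. by move=> /hausdorff_accessible/accessible_closed_set1. Qed.

Lemma closed_nbhs_sub (K : topologicalType) (x : K) (U : set K) :
  compact_hausdorff K -> nbhs x U ->
  exists C, [/\ closed C, nbhs x C & C `<=` U].
Proof.
move=> hK xU; have [V xV VU] :=
  compact_regular hK.2 hK.1 (filterT : nbhs x [set: K]) xU.
exists (closure V); split=> //; first exact: closed_closure.
exact: filterS (@subset_closure _ V) xV.
Qed.

Lemma disjoint_closed_nbhs (K : topologicalType) (z w : K) :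
  compact_hausdorff K -> z <> w -> exists C C',
    [/\ closed C, closed C', nbhs z C, nbhs w C' & forall v, C v -> ~ C' v].
Proof.
move=> hK zw.
have [[A B] /= [/set_mem Az /set_mem Bw] [Ao Bo /eqP AB]] : exists2 AB : set K * set K,
    (z \in AB.1 /\ w \in AB.2) &
    [/\ open AB.1, open AB.2 & AB.1 `&` AB.2 == set0].
  by have := hK.2; rewrite open_hausdorff; apply; exact/eqP.
have [C [Cc zC CA]] := closed_nbhs_sub hK (open_nbhs_nbhs (conj Ao Az)).
have [C' [C'c wC' C'B]] := closed_nbhs_sub hK (open_nbhs_nbhs (conj Bo Bw)).
exists C, C'; split=> // v /CA Av /C'B Bv.
by have : (A `&` B) v by []; rewrite AB.
Qed.

Lemma compact_embedding (S T : topologicalType) (f : S -> T) :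
  compact_hausdorff S -> hausdorff_space T -> continuous f -> injective f ->
  embedding f.
Proof.
move=> hS hT fc finj; split=> // U Uo; exists (~` (f @` (~` U))).
  apply: closed_openC; apply: (compact_closed_map hS.1) => //.
  exact: open_closedC.
apply/seteqP; split=> [_ [x Ux <-]|_ [[x _ <-] nfx]].
  by split=> //; move=> [y nUy /finj yx]; rewrite yx in nUy.
by exists x => //; apply: contrapT => nUx; apply: nfx; exists x.
Qed.

Lemma ptws_continuous (X : topologicalType) (I : Type) (Y : topologicalType)
    (f : X -> {ptws I -> Y}) :
  (forall i, continuous (fun x => f x i)) -> continuous f.
Proof.
by move=> fc x; apply/cvg_sup => i; apply: continuous_comp_initial; exact: fc.
Qed.

Lemma ptws_coord_continuous (X : topologicalType) (I : Type) (Y : topologicalType)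
    (f : X -> {ptws I -> Y}) (i : I) :
  continuous f -> continuous (fun x => f x i).
Proof.
move=> fc x U Ux; have /cvg_sup/(_ i) h := fc x.
apply: (h [set g | U (g i)]).
exact: (@initial_continuous _ _ (fun g : I -> Y => g i) (f x) U Ux).
Qed.

(** * Countable sets and well-orders *)

Lemma countable_sub (T : Type) (A B : set T) :
  A `<=` B -> countable B -> countable A.
Proof. by move=> /subset_card_le; exact: sub_countable. Qed.

Lemma countable_image (T U : Type) (f : T -> U) (A : set T) :
  countable A -> countable (f @` A).
Proof. exact/sub_countable/card_image_le. Qed.

Lemma countable_setU (T : Type) (A B : set T) :
  countable A -> countable B -> countable (A `|` B).
Proof.
move=> cA cB; rewrite (_ : A `|` B = \bigcup_(b : bool) if b then A else B).
  by apply: bigcup_countable => // -[].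
apply/seteqP; split=> [x [?|?]|x [[] _ ?]];
  by [exists true|exists false|left|right].
Qed.

Lemma countable_enum (T : Type) (A : set T) : countable A -> A !=set0 ->
  exists2 e : nat -> T, (forall n, A (e n)) & forall a, A a -> exists n, e n = a.
Proof.
move=> /countable_injP[f finj] [a0 Aa0].
have /choice[e he] n : exists a, A a /\ (forall b, A b -> f b = n -> a = b).
  have [[b [Ab fb]]|nb] := pselect (exists b, A b /\ f b = n); last first.
    by exists a0; split=> // b Ab fb; case: nb; exists b.
  by exists b; split=> // c Ac fc; apply: finj; rewrite ?inE// fb.
exists e => [n|a Aa]; first by case: (he n).
by exists (f a); have [_] := he (f a); apply.
Qed.

(** Values in [option T] make the enumeration available for the empty set too. *)
Lemma countable_enum_option (T : Type) (A : set T) : countable A ->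
  exists e : nat -> option T, forall g, A g <-> exists n, e n = Some g.
Proof.
move=> cA; have [[g0 Ag0]|nA] := pselect (A !=set0); last first.
  exists (fun=> None) => g; split=> [Ag|[]//]; by case: nA; exists g.
have [e eA Ae] := countable_enum cA (ex_intro _ g0 Ag0).
exists (Some \o e) => g; split=> [/Ae[n <-]|[n [<-]]]; by [exists n|].
Qed.

Lemma well_order_exists (T : eqType) : exists lt : T -> T -> Prop,
  [/\ well_founded lt, (forall x y z, lt x y -> lt y z -> lt x z) &
      forall x y, [\/ lt x y, x = y | lt y x]].
Proof.
have [le wo] := wochoice.well_ordering_principle T.
have lemin (A : set T) : A !=set0 -> exists2 z, A z & forall x, A x -> le z x.
  move=> [a Aa]; have [|z [[Az lez] _]] := wo (mem A).
    by exists a; rewrite inE.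
  by exists z => [|x Ax]; [rewrite inE in Az|apply: lez; rewrite inE].
have lexx x : le x x by have [|z -> h] := lemin [set x]; [exists x|exact: h].
have letot x y : le x y \/ le y x.
  have [|z [->|->] h] := lemin [set x; y]; first by exists x; left.
    by left; apply: h; right.
  by right; apply: h; left.
have leanti x y : le x y -> le y x -> x = y.
  move=> xy yx; have [|z [_ zu]] := wo (mem [set x; y]).
    by exists x; rewrite inE; left.
  rewrite -(zu x) ?(zu y) //; split; rewrite ?inE; [by right| |by left|];
  by move=> w; rewrite inE => -[->|->].
have letr x y z : le x y -> le y z -> le x z.
  move=> xy yz.
  have [|w [[->|->]|->] h] := lemin [set x; y; z]; first by exists x; do 2 left.
  - by apply: h; right.
  - by rewrite (leanti x y) // h //; left; left.
  - by rewrite -(leanti y z) // h //; left; right.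
exists (fun x y => le x y /\ x <> y); split=> [|x y z [xy nxy] [yz nyz]|x y].
- move=> x; apply: contrapT => nx.
  have [|z nz hz] := lemin [set x | ~ Acc (fun x y => le x y /\ x <> y) x].
    by exists x.
  apply: nz; constructor => y [yz nyz]; apply: contrapT => ny.
  by apply: nyz; apply: leanti => //; exact: hz.
- split; first exact: letr yz.
  by move=> xz; apply: nxy; apply: leanti => //; rewrite xz.
- have [->|/eqP nxy] := eqVneq x y; first by constructor 2.
  have [xy|yx] := letot x y; first by constructor 1.
  by constructor 3; split=> // /esym.
Qed.

Lemma uncountable_set_nat : ~ countable [set: set nat].
Proof.
move=> /countable_injP[f finj].
pose A : set nat := [set n | exists X : set nat, f X = n /\ ~ X n].
have Ainj X : f X = f A -> X = A by move=> e; apply: finj; rewrite ?inE.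
have nA : ~ A (f A) by move=> [X [/Ainj -> nX]]; apply: (nX); exists A.
by apply: (nA); exists A.
Qed.

(** The ordinal omega_1: the elements with countably many predecessors, in a
well-order of an uncountable set, form an initial segment which cannot be
countable, since otherwise the first element outside would belong to it. *)
Lemma omega1_exists : exists (W : Type) (lt : W -> W -> Prop),
  [/\ inhabited W, well_founded lt, (forall x y z, lt x y -> lt y z -> lt x z),
      forall x y, [\/ lt x y, x = y | lt y x] &
      (forall w, countable [set u | lt u w]) /\
      (forall e : nat -> W, exists w, forall n, lt (e n) w)].
Proof.
have [lt [wf tr tot]] := well_order_exists (set nat : eqType).
pose Wset := [set w | countable [set u | lt u w]].
have Wunc : ~ countable Wset.
  move=> cW; have [nW|/existsNP[w nw]] := pselect (forall w, Wset w).
    by apply: uncountable_set_nat; apply: countable_sub cW.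
  elim: (wf w) nw => {}w _ IH; apply; apply: countable_sub cW => u uw.
  by apply: contrapT => nu; exact: IH uw nu.
have bounded (e : nat -> set_type Wset) : exists w : set_type Wset, forall n, lt (val (e n)) (val w).
  apply: contrapT => nb; apply: Wunc.
  apply: (@countable_sub _ _ (\bigcup_n ([set u | lt u (val (e n))] `|` [set val (e n)]))).
    move=> w Ww; apply: contrapT => nw; apply: nb.
    exists (SigSub (mem_set Ww)) => n /=.
    have [//|ew|wlt] := tot (val (e n)) w; case: nw; exists n => //; first by right.
    by left.
  apply: bigcup_countable => // n _; apply: countable_setU; last exact: countable1.
  exact: set_valP (e n).
exists (set_type Wset), (fun u w => lt (val u) (val w)); split.
- have [[w Ww]|nW] := pselect (exists w, Wset w).
    exact: (inhabits (SigSub (mem_set Ww))).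
  by case: Wunc; apply: (@countable_sub _ _ set0) => [w Ww|];
    [case: nW; exists w|exact: countable0].
- move=> w; move: {2}(val w) (erefl (val w)) => y.
  elim: (wf y) w => {}y _ IH w wy; constructor => u uw.
  by apply: (IH (val u)) => //; rewrite -wy.
- by move=> x y z; exact: tr.
- move=> x y; have [?|/val_inj ?|?] := tot (val x) (val y).
  + by constructor 1.
  + by constructor 2.
  + by constructor 3.
- split=> // w; have /countable_injP[f finj] := set_valP w.
  apply/countable_injP; exists (f \o val) => u v; rewrite !inE => /= uw vw fe.
  by apply: val_inj; apply: finj; rewrite ?inE.
Qed.

(** * Retractional skeletons and the sets they induce *)

Lemma nondecreasing_homo (d : Order.disp_t) (G : porderType d) (u : nat -> G) :
  (forall n, (u n <= u n.+1)%O) -> forall i j, (i <= j)%N -> (u i <= u j)%O.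
Proof. by move=> h; apply: (@homo_leq _ u <=%O) => // y x z; exact: le_trans. Qed.

Section Skeleton.
Variables (R : realType) (K : topologicalType).
Hypothesis hK : compact_hausdorff K.
Variables (d : Order.disp_t) (G : porderType d) (r : G -> K -> K).
Hypothesis sk : r_skeleton R r.

(** Known as the set induced by the skeleton. *)
Definition skeleton_core : set K := [set x | exists s, r s x = x].

Lemma rsk_cont s : continuous (r s).
Proof. exact: (rsk_retraction sk s).1. Qed.

Lemma rsk_idem s x : r s (r s x) = r s x.
Proof. exact: (rsk_retraction sk s).2. Qed.

Lemma rsk_lower s t x : (s <= t)%O -> r s (r t x) = r s x.
Proof. by move=> st; have [/(congr1 (@^~ x))/= <- _] := rsk_commute sk st. Qed.

Lemma rsk_upper s t x : (s <= t)%O -> r t (r s x) = r s x.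
Proof. by move=> st; have [_ /(congr1 (@^~ x))/= <-] := rsk_commute sk st. Qed.

Lemma rsk_fix_le s t x : (s <= t)%O -> r s x = x -> r t x = x.
Proof. by move=> st sx; rewrite -sx rsk_upper. Qed.

Lemma rsk_fix_closed s : closed [set x | r s x = x].
Proof. by apply: (closed_eqfun hK.2 (@rsk_cont s)) => x; exact: cvg_id. Qed.

Lemma rsk_near x U : nbhs x U ->
  exists s0, forall t, (s0 <= t)%O -> U (r t x).
Proof.
by move=> xU; have [s0 _ hs0] := rsk_lim sk xU; exists s0 => t st; exact: hs0.
Qed.

Lemma rsk_ub s t : exists u : G, (s <= u)%O /\ (t <= u)%O.
Proof. by case: (rsk_directed sk). Qed.

(** The axiom on suprema speaks of strictly increasing sequences. A
nondecreasing sequence is eventually constant or has a strictly increasing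
subsequence, which accounts for [phi]. *)
Lemma rsk_sup_le (u : nat -> G) : (forall n, (u n <= u n.+1)%O) ->
  exists t (phi : nat -> nat), (forall n, (u n <= t)%O) /\
    forall x, r (u (phi n)) x @[n --> \oo] --> r t x.
Proof.
move=> u1; have um := nondecreasing_homo u1.
have [[N hN]|nN] := pselect (exists N, forall n, (N <= n)%N -> u n = u N).
  exists (u N), (fun=> N); split=> [n|x]; last exact: cvg_cst.
  by have [/um //|/ltnW/hN ->] := leqP n N.
have {}nN N : exists n, (N < n)%N /\ (u N < u n)%O.
  apply: contrapT => h; apply: nN; exists N => n Nn.
  apply: contrapT => ne; apply: h; exists n.
  rewrite lt_neqAle um // andbT ltn_neqAle Nn andbT.
  by split; apply/eqP => e; apply: ne; rewrite e.
have [g hg] := choice nN.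
pose phi n := iter n g 0%N.
have phiS n : (u (phi n) < u (phi n.+1))%O by have [] := hg (phi n).
have phin n : (n <= phi n)%N.
  by elim: n => // n IH; apply: leq_ltn_trans IH _; have [] := hg (phi n).
have [t [tub _] tl] := rsk_sup sk phiS.
exists t, phi; split=> // n; apply: le_trans (um _ _ (phin n)) _.
by apply: tub; exists n.
Qed.

End Skeleton.

Section SkeletonCore.
Variables (R : realType) (K : topologicalType).
Hypothesis hK : compact_hausdorff K.
Variables (d : Order.disp_t) (G : porderType d) (r : G -> K -> K).
Hypothesis sk : r_skeleton R r.

(** The metric of the range of [r s], pulled back along [r s]. *)
Lemma rsk_pseudometric s : exists D : K -> K -> R,
  [/\ forall x y, 0 <= D x y,
      forall x y, D x y = 0 <-> r s x = r s y,
      forall x y z, D x z <= D x y + D y z,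
      forall x y, D x y = D y x &
      forall x, continuous (D x)].
Proof.
have [D [D0 De Ds Dt Dn]] := rsk_metrizable sk s.
pose p x : set_type (range (r s)) := SigSub (mem_set (imageT (r s) x)).
have pc : continuous p by apply: continuous_comp_initial; exact: rsk_cont sk s.
exists (fun x y => D (p x) (p y)); split=> // [x y|x y].
  by rewrite De; split=> [/(congr1 val)//|e]; exact: val_inj.
apply/cvgrPdist_lt => e e0.
have yz : nbhs y (p @^-1` [set z | D (p y) z < e]).
  by apply: (pc y); rewrite [nbhs _]Dn; exists e.
apply: filterS yz => z /= lt.
have h1 := Dt (p x) (p y) (p z); have h2 := Dt (p x) (p z) (p y).
rewrite (Ds (p z)) in h2; rewrite ltr_norml; lra.
Qed.

Lemma skeleton_core_dense (U : set K) : open U -> U !=set0 ->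
  U `&` skeleton_core r !=set0.
Proof.
move=> Uo [x Ux]; have [s hs] := rsk_near sk (open_nbhs_nbhs (conj Uo Ux)).
by exists (r s x); split; [exact: hs|exists s; exact: rsk_idem sk _ _].
Qed.

(** Closing off: indices [u n] of [C] and points [m n] of [M] are chosen in
turn, [m n] being 1/(n+1)-close to [x] for the pseudometrics of
[u 0, ..., u n] and fixed by [r (u n.+1)]. With [t] above all [u n], a
cluster point [v] of the sequence is fixed by [r t] and is not separated from
[x] by any [r (u n)], hence [v = r t v = r t x]. The set [C] is there to keep
[r t x] in a closed set prescribed in advance. *)
Lemma skeleton_frechet_urysohn (C : set G) (M : set K) (x : K) (s0 : G) :
  (forall s, exists2 t, C t & (s <= t)%O) ->
  M `<=` skeleton_core r -> closure M x ->
  exists t (m : nat -> K), [/\ (s0 <= t)%O, forall n, M (m n) /\ r t (m n) = m n,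
    m @ \oo --> r t x & closure [set r s x | s in C] (r t x)].
Proof.
move=> Ccof MD Mx.
have [D hD] := choice rsk_pseudometric.
pose dl s y := D s x y.
have dl0 s : dl s x = 0 by have [_ h _ _ _] := hD s; exact/h.
have dlge0 s y : 0 <= dl s y by have [h _ _ _ _] := hD s; exact: h.
have dlc s : continuous (dl s) by have [_ _ _ _ h] := hD s; exact: h.
have /choice[pC hC] : forall s, exists t, C t /\ (s <= t)%O.
  by move=> s; have [t] := Ccof s; exists t.
have /choice[ub hub] : forall st : G * G, exists u, (st.1 <= u)%O /\ (st.2 <= u)%O.
  by move=> st; exact: rsk_ub sk _ _.
have /choice[c hc] : forall m, exists s, M m -> r s m = m.
  move=> m; have [/MD [s ?]|nM] := pselect (M m); first by exists s.
  by exists s0.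
have /choice[pm hpm] : forall nh : nat * (K -> R), exists m,
    {for x, continuous nh.2} -> nh.2 x = 0 -> M m /\ nh.2 m < nh.1.+1%:R^-1.
  move=> [n h] /=; have [[hcx hx]|nh] :=
      pselect ({for x, continuous h} /\ h x = 0); last first.
    by exists x => hcx hx; case: nh.
  have /(closure_exists Mx)[m Mm hm] : nbhs x [set y | h y < n.+1%:R^-1].
    apply: (hcx [set z | z < n.+1%:R^-1]); apply: lt_nbhsl.
    by rewrite hx invr_gt0.
  by exists m.
(* the state is an index together with the sum of the pseudodistances to [x]
   for the indices met so far, so that one inequality controls all of them *)
pose step n (uh : G * (K -> R)) : G * (K -> R) :=
  let u' := pC (ub (uh.1, c (pm (n, uh.2)))) in
  (u', fun y => uh.2 y + dl u' y).
pose S := fix S n := if n is n'.+1 then step n' (S n') else (pC s0, dl (pC s0)).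
pose u n := (S n).1; pose h n := (S n).2; pose m n := pm (n, h n).
have hS n y : h n.+1 y = h n y + dl (u n.+1) y by [].
have hcont n : {for x, continuous (h n)}.
  elim: n => [|n IH]; first exact: dlc.
  by apply: cvgD; [exact: IH|exact: dlc].
have h0 n : h n x = 0.
  by elim: n => [|n IH]; [exact: dl0|rewrite hS IH dl0 addr0].
have hge0 n y : 0 <= h n y.
  by elim: n => [|n IH]; [exact: dlge0|rewrite hS; exact: addr_ge0].
have hm n : M (m n) /\ h n (m n) < n.+1%:R^-1 by exact: (hpm (n, h n) (hcont n) (h0 n)).
have uC n : C (u n) by case: n => [|n]; exact: (hC _).1.
have uS n : (ub (u n, c (m n)) <= u n.+1)%O by exact: (hC _).2.
have uinc n : (u n <= u n.+1)%O.
  by apply: le_trans (uS n); exact: (hub (u n, c (m n))).1.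
have rm n : r (u n.+1) (m n) = m n.
  apply: (rsk_fix_le sk (le_trans _ (uS n))); first exact: (hub (u n, c (m n))).2.
  by apply: hc; case: (hm n).
have hdl n i y : (i <= n)%N -> dl (u i) y <= h n y.
  elim: n => [|n IH]; first by rewrite leqn0 => /eqP ->.
  rewrite leq_eqVlt => /orP[/eqP ->|/IH]; first by rewrite hS lerDr.
  by move=> le; rewrite hS; apply: le_trans le _; rewrite lerDl.
have [t [phi [ut tl]]] := rsk_sup_le sk uinc.
have rtm n : r t (m n) = m n by exact: (rsk_fix_le sk (ut n.+1) (rm n)).
exists t, m; split.
- by apply: le_trans (ut 0%N); exact: (hC s0).2.
- by move=> n; split=> //; case: (hm n).
- apply: (cluster_unique_cvg hK) => v cv.
  have rtv : r t v = v.
    apply: (cluster_closed (rsk_fix_closed hK sk (s := t)) _ cv).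
    by exists 0%N => // n _; exact: rtm.
  rewrite -rtv; apply: (cvg_unique hK.2 (tl v)).
  suff e i : r (u i) x = r (u i) v.
    have -> : (fun n => r (u (phi n)) v) = (fun n => r (u (phi n)) x).
      by apply/funext => n; rewrite e.
    exact: tl.
  have [_ /(_ x v)[e _] _ _ _] := hD (u i); apply: e; apply/eqP.
  rewrite eq_le (dlge0 (u i)) andbT; apply/ler_addgt0Pl => e e0; rewrite addr0.
  have [N Ni Ne] : exists2 N, (i <= N)%N & N.+1%:R^-1 <= e.
    have [N _ hN] := near_infty_natSinv_lt (PosNum e0).
    exists (maxn N i); first exact: leq_maxr.
    by apply/ltW/hN => /=; exact: leq_maxl.
  apply: (@cluster_closed _ (m @ \oo) [set y | dl (u i) y <= e]) cv.
    by apply: (@closed_comp _ _ (dl (u i)) [set z | z <= e]) => [y _|];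
      [exact: dlc|exact: closed_le].
  exists N => // n Nn /=; apply: le_trans (hdl n i _ (leq_trans Ni Nn)) _.
  apply: le_trans Ne; apply: le_trans (ltW (hm n).2) _.
  by rewrite lef_pV2 ?posrE ?ltr0n // ler_nat.
- apply: (@closed_cvg _ _ \oo _ _ _ (@closed_closure _ _) _ _ (tl x)).
  by apply: nearW => n; apply: subset_closure; exists (u (phi n)).
Qed.

(** Say [r s p] is in [P] for cofinally many [s]. As the points of the core in
[Q `\` P] accumulate at [p], [skeleton_frechet_urysohn] gives [t] with [r t p] in [P]
and [r t p] a limit of points of [Q], so that [r t p = p]. *)
Lemma skeleton_forcing (P Q : set K) p : closed P -> closed Q ->
  P `&` Q `<=` [set p] -> nbhs p (P `|` Q) ->
  closure (~` P) p -> closure (~` Q) p -> skeleton_core r p.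
Proof.
wlog Pcof : P Q / forall s, exists2 t, P (r t p) & (s <= t)%O.
  move=> W Pc Qc PQ nPQ nP nQ.
  have [/W|] := pselect (forall s, exists2 t, P (r t p) & (s <= t)%O).
    by apply; eassumption.
  move=> /existsNP[s hs]; apply: (W Q P) => //; rewrite 1?setIC 1?setUC // => s'.
  have [s1 hs1] := rsk_near sk nPQ.
  have [s2 [ss2 s's2]] := rsk_ub sk s s'.
  have [s3 [s23 s13]] := rsk_ub sk s2 s1.
  exists s3; last exact: le_trans s23.
  have [Ps3|//] := hs1 _ s13; case: hs; exists s3 => //; exact: le_trans s23.
move=> Pc Qc PQ nPQ nP _; have [s0] : inhabited G by case: (rsk_directed sk).
have Mp : closure (skeleton_core r `&` (Q `\` P)) p.
  move=> U; rewrite nbhsE => -[V [Vo Vp] VU].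
  have [x [nPx [Vx PQx]]] :=
    nP _ (filterI (open_nbhs_nbhs (conj Vo Vp)) (nbhs_interior nPQ)).
  have [|y [[[Vy PQy] nPy] Dy]] :=
    @skeleton_core_dense (V `&` (P `|` Q)^° `&` ~` P) _ (ex_intro _ x (conj (conj Vx PQx) nPx)).
    by apply: openI; [apply: openI => //; exact: open_interior|
                      exact: closed_openC].
  exists y; split; last exact: VU.
  by split=> //; split=> //; have [|] := interior_subset PQy.
have [t [m [_ hm mt tP]]] := skeleton_frechet_urysohn s0 Pcof
  (@subIsetl _ (skeleton_core r) (Q `\` P)) Mp.
exists t; apply: PQ; split.
  by apply: Pc; apply: closureS tP => _ [s Ps <-].
apply: (@closed_cvg _ _ \oo _ _ _ Qc _ _ mt); apply: nearW => n.
by have [[_ []]] := hm n.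
Qed.

End SkeletonCore.

(** * Directed families of retractions of a full skeleton *)

Section FullSkeleton.
Variables (R : realType) (K : topologicalType).
Hypothesis hK : compact_hausdorff K.
Variables (d : Order.disp_t) (G : porderType d) (r : G -> K -> K).
Hypothesis sk : r_skeleton R r.

Definition directed (T : set G) := T !=set0 /\
  forall s t, T s -> T t -> exists u, [/\ T u, (s <= u)%O & (t <= u)%O].

Lemma directed_chain (T : set G) (c : nat -> G) :
  directed T -> (forall n, T (c n)) ->
  exists u : nat -> G, [/\ forall n, T (u n), forall n, (u n <= u n.+1)%O &
    forall n, (c n <= u n)%O].
Proof.
move=> [_ Tdir] Tc.
have /choice[ub hub] : forall st : G * G, exists u,
    T st.1 -> T st.2 -> [/\ T u, (st.1 <= u)%O & (st.2 <= u)%O].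
  move=> [s t] /=; have [[Ts Tt]|nT] := pselect (T s /\ T t).
    by have [u] := Tdir _ _ Ts Tt; exists u.
  by exists s => Ts Tt; case: nT.
pose u := fix u n := if n is n'.+1 then ub (u n', c n) else c 0%N.
have Tu n : T (u n).
  by elim: n => //= n IH; have [] := hub (u n, c n.+1) IH (Tc _).
exists u; split=> // n; first by have [] := hub (u n, c n.+1) (Tu _) (Tc _).
by case: n => [|n] //=; have [] := hub (u n, c n.+1) (Tu _) (Tc _).
Qed.

Definition hull (T : set G) : set K :=
  closure [set x | exists2 s, T s & r s x = x].

Lemma hull_mono (T T' : set G) : T `<=` T' -> hull T `<=` hull T'.
Proof. by move=> TT'; apply: closureS => x [s /TT' Ts e]; exists s. Qed.

Lemma hull_ub (T : set G) t x : (forall s, T s -> (s <= t)%O) -> hull T x -> r t x = x.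
Proof.
move=> Tt hx; apply: (rsk_fix_closed hK sk).
by apply: closureS hx => y [s /Tt st /(rsk_fix_le sk st)].
Qed.

Lemma hull_fix (T : set G) s x : T s -> r s x = x -> hull T x.
Proof. by move=> Ts e; apply: subset_closure; exists s. Qed.

Hypothesis full : forall x, skeleton_core r x.

(** Countable tightness, in terms of indices. *)
Lemma hull_countable (T : set G) y : hull T y ->
  exists2 c : nat -> G, (forall n, T (c n)) & hull (range c) y.
Proof.
move=> hy; have [s sy] := full y.
have Gcof s' : exists2 t : G, [set: G] t & (s' <= t)%O by exists s'.
have [t [m [st hm mt _]]] := skeleton_frechet_urysohn hK sk s Gcof
  (fun x _ => full x) hy.
have rty := rsk_fix_le sk st sy; rewrite rty in mt.
have /choice[c hc] n : exists s, T s /\ r s (m n) = m n.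
  by have [[s' ? ?] _] := hm n; exists s'.
exists c => [n|]; first by case: (hc n).
apply: (@closed_cvg _ _ \oo _ _ _ (@closed_closure _ _) _ _ mt).
apply: nearW => n; apply: subset_closure.
by exists (c n); [exists n|case: (hc n)].
Qed.

(** By countable tightness [y] and [y'] are in the hull of one increasing
sequence of [T], whose supremum [t], possibly outside [T], fixes them both;
they are then the limits of the same sequence. *)
Lemma hull_sep (T : set G) y y' : directed T -> hull T y -> hull T y' ->
  (forall s, T s -> r s y = r s y') -> y = y'.
Proof.
move=> Tdir /hull_countable[c Tc hy] /hull_countable[c' Tc' hy'] e.
have [u [Tu u1 cu]] := directed_chain Tdir Tc.
have [u' [Tu' u'1 cu']] := directed_chain Tdir Tc'.
have /choice[w hw] n : exists w, [/\ T w, (u n <= w)%O & (u' n <= w)%O].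
  by case: Tdir => _; apply.
have Tw n : T (w n) by case: (hw n).
have [v [Tv v1 wv]] := directed_chain Tdir Tw.
have [t [phi [vt tl]]] := rsk_sup_le sk v1.
have wt n : (w n <= t)%O by exact: le_trans (vt n).
have <- : r t y = y.
  apply: hull_ub hy => _ [n _ <-]; apply: le_trans (cu n) _.
  by apply: le_trans (wt n); case: (hw n).
have <- : r t y' = y'.
  apply: hull_ub hy' => _ [n _ <-]; apply: le_trans (cu' n) _.
  by apply: le_trans (wt n); case: (hw n).
apply: (cvg_unique hK.2 (tl y)).
rewrite (_ : (fun n => _) = (fun n => r (v (phi n)) y')); first exact: tl.
by apply/funext => n; exact: e.
Qed.

(** The limit of the net [r s x], [s] in [T], described by the conditions that
determine it. *)
Definition dretract (T : set G) (x : K) : K :=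
  xget x [set y | hull T y /\ forall s, T s -> r s y = r s x].

Section DirectedRetraction.
Variable T : set G.
Hypothesis Tdir : directed T.

Lemma dretractP x : hull T (dretract T x) /\ forall s, T s -> r s (dretract T x) = r s x.
Proof.
suff [y hy] : exists y, hull T y /\ forall s, T s -> r s y = r s x.
  by rewrite /dretract; case: xgetP => [z _ //|/(_ y)].
have [[s0 Ts0] Tub] := Tdir.
pose F : set_system K :=
  filter_from T (fun s => [set r t x | t in [set t | T t /\ (s <= t)%O]]).
have FF : ProperFilter F.
  apply: filter_from_proper; last by move=> s Ts; exists (r s x), s.
  apply: filter_from_filter; first by exists s0.
  move=> s s' Ts Ts'; have [u [Tu su s'u]] := Tub _ _ Ts Ts'; exists u => //.
  by move=> _ [t [Tt ut] <-]; split; exists t => //; split=> //;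
    exact: le_trans ut.
have [y cy] := cluster_exists hK FF; exists y; split=> [|s Ts].
  apply: (cluster_closed (@closed_closure _ _) _ cy); exists s0 => //.
  move=> _ [t [Tt _] <-]; apply: (hull_fix Tt); exact: rsk_idem sk _ _.
apply: (@cluster_closed _ F [set z | r s z = r s x] y _ _ cy).
  by apply: (closed_eqfun hK.2); [exact: rsk_cont sk _|move=> z; exact: cvg_cst].
by exists s => // _ [t [Tt st] <-] /=; rewrite (rsk_lower sk).
Qed.

Lemma dretract_fix x : hull T x -> dretract T x = x.
Proof. by move=> hx; have [h e] := dretractP x; exact: hull_sep Tdir _ _ _. Qed.

Lemma dretract_eq x y : (forall s, T s -> r s x = r s y) -> dretract T x = dretract T y.
Proof.
move=> e; have [hx ex] := dretractP x; have [hy ey] := dretractP y.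
by apply: (hull_sep Tdir) => // s Ts; rewrite ex// ey// e.
Qed.

(** A map into a compact space with closed graph is continuous. *)
Lemma dretract_cont : continuous (dretract T).
Proof.
move=> x; apply: (cluster_unique_cvg hK) => y cy.
have [hx ex] := dretractP x; apply: (hull_sep Tdir) => //.
  apply: (cluster_closed (@closed_closure _ _) _ cy).
  by apply: (@filterE _ (nbhs x)) => z; case: (dretractP z).
move=> s Ts; rewrite ex //.
have /(cluster_map (@rsk_cont _ _ _ _ _ sk s y)) := cy.
have -> : r s @ (dretract T @ x) = r s @ x.
  apply/funext => A; congr (nbhs x _); apply/funext => z.
  by rewrite /preimage /= (dretractP z).2.
exact/(cvg_cluster_eq hK.2)/(rsk_cont sk).
Qed.

End DirectedRetraction.

Lemma dretract_lower (T T' : set G) x : directed T -> directed T' -> T `<=` T' ->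
  dretract T (dretract T' x) = dretract T x.
Proof.
move=> dT dT' TT'; apply: dretract_eq => // s /TT' Ts.
by have [_ ->] := dretractP dT' x.
Qed.

End FullSkeleton.

(** * A full skeleton gives point-countable coordinates *)

Section PointCountable.
Variables (R : realType) (K : topologicalType).
Hypothesis hK : compact_hausdorff K.
Variables (d : Order.disp_t) (G : porderType d) (r : G -> K -> K).
Hypothesis sk : r_skeleton R r.

Definition continuous_unit (f : K -> R) := continuous f /\ forall x, 0 <= f x <= 1.

(** The distances to the points of finite 1/(n+1)-nets of the range of [r s],
truncated at 1. *)
Lemma rsk_countable_separating s : exists F : set (K -> R),
  [/\ countable F, F `<=` continuous_unit &
    forall x y, (forall f, F f -> f x = f y) -> r s x = r s y].
Proof.
have [D [D0 De Dt Ds Dc]] := rsk_pseudometric sk s.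
have Dxx x : D x x = 0 by exact/De.
have /choice[l hl] n : exists l : seq K, forall y, exists2 a, a \in l &
    D a y < n.+1%:R^-1.
  apply: contrapT => nl.
  (* if no finite set is a net, the sets of points far from finite sets generate
     a proper filter, which cannot cluster *)
  pose F : set_system K := filter_from [set: seq K]
    (fun l => [set y | forall a, a \in l -> n.+1%:R^-1 <= D a y]).
  have FF : ProperFilter F.
    apply: filter_from_proper => [|l _]; last first.
      apply: contrapT => h; apply: nl; exists l => y; apply: contrapT => ny.
      apply: h; exists y => a al; rewrite leNgt; apply/negP => lt.
      by apply: ny; exists a.
    apply: filter_from_filter; first by exists [::].
    move=> l l' _ _; exists (l ++ l') => // y hy.
    by split=> a al; apply: hy; rewrite mem_cat al ?orbT.
  have [y cy] := cluster_exists hK FF.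
  have nb : nbhs y [set z | D y z < n.+1%:R^-1].
    apply: (Dc y y [set z | z < n.+1%:R^-1]).
    by apply: lt_nbhsl; rewrite Dxx invr_gt0.
  have Fb : F [set z | n.+1%:R^-1 <= D y z].
    by exists [:: y] => // z /(_ y); rewrite /= mem_head; exact.
  by have [z [/= h lt]] := cy _ _ Fb nb; move: lt; rewrite ltNge h.
pose f a y := Num.min 1 (D a y).
exists (\bigcup_n [set f a | a in [set` l n]]); split.
- apply: bigcup_countable => // n _; apply: countable_image.
  exact/finite_set_countable/finite_seq.
- move=> _ [n _ [a _ <-]]; split=> [|x].
    by apply: min_fun_continuous => [x|]; [exact: cvg_cst|exact: Dc].
  by rewrite /f le_min ler01 D0 ge_min lexx.
- move=> x y e; apply/De/eqP; rewrite eq_le D0 andbT.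
  apply/ler_addgt0Pl => e0 e00; rewrite addr0.
  have [n0 hn0] : exists n : nat, n.+1%:R^-1 <= Num.min (e0 / 2) (1 / 2).
    have m0 : 0 < Num.min (e0 / 2) (1 / 2) :> R.
      by rewrite lt_min !divr_gt0.
    have [N _ hN] := near_infty_natSinv_lt (PosNum m0).
    by exists N; apply/ltW/(hN N) => /=.
  have [a al ax] := hl n0 x.
  have := e (f a) (ex_intro2 _ _ n0 I (ex_intro2 _ _ a al erefl)).
  have h1 : D a x < 1 / 2 by apply: lt_le_trans ax (le_trans hn0 _); rewrite ge_min lexx orbT.
  have h2 : D a x < e0 / 2 by apply: lt_le_trans ax (le_trans hn0 _); rewrite ge_min lexx.
  rewrite /f (min_r (_ : D a x <= 1)); last by lra.
  have := Dt x a y; rewrite (Ds x a) => h3.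
  by have [h|h] := lerP 1 (D a y); lra.
Qed.

Hypothesis full : forall x, skeleton_core r x.
Variables (base : G) (ub : G * G -> G).
Hypothesis hub : forall st, (st.1 <= ub st)%O /\ (st.2 <= ub st)%O.

(** The directed set of indices generated by [S]. The element [base] keeps it
nonempty when [S] is empty. *)
Inductive gen (S : set G) : set G :=
| gen_base : gen S base
| gen_in s of S s : gen S s
| gen_ub s t of gen S s & gen S t : gen S (ub (s, t)).

Lemma gen_directed S : directed (gen S).
Proof.
split=> [|s t Ss St]; first by exists base; exact: gen_base.
by exists (ub (s, t)); have [? ?] := hub (s, t); split=> //; exact: gen_ub.
Qed.

Lemma gen_mono S S' : S `<=` S' -> gen S `<=` gen S'.
Proof.
move=> SS' s; elim=> [|{}s /SS'|{}s t _ Ss _ St].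
- exact: gen_base.
- exact: gen_in.
- exact: gen_ub.
Qed.

Lemma gen_countable S : countable S -> countable (gen S).
Proof.
move=> cS.
pose D := fix D n := if n is n'.+1 then D n' `|` ub @` (D n' `*` D n')
                     else base |` S.
apply: (@countable_sub _ _ (\bigcup_n D n)); last first.
  apply: bigcup_countable => // n _; elim: n => [|n IH].
    by apply: countable_setU => //; exact: countable1.
  by apply: countable_setU => //; apply: countable_image; exact: countableX.
have Dm i j : (i <= j)%N -> D i `<=` D j.
  elim: j => [|j IH]; first by rewrite leqn0 => /eqP ->.
  by rewrite leq_eqVlt => /orP[/eqP ->//|/IH h x /h ?]; left.
move=> s; elim=> [|{}s Ss|{}s t _ [i _ Di] _ [j _ Dj]].
- by exists 0%N => //; left.
- by exists 0%N => //; right.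
- exists (maxn i j).+1 => //; right; exists (s, t) => //; split.
    by apply: Dm Di; exact: leq_maxl.
  by apply: Dm Dj; exact: leq_maxr.
Qed.

Let p S := dretract r (gen S).
Let pP S x : hull r (gen S) (p S x) /\ forall s, gen S s -> r s (p S x) = r s x.
Proof. exact (dretractP hK sk (gen_directed S) x). Qed.

(** The property proved by induction: the retraction attached to the indices
generated by [S] factors through a Sigma-product. The functions are defined on
all of [K], so that no subspace appears. *)
Definition coordinatized (S : set G) := exists F : set (K -> R),
  [/\ F `<=` continuous_unit,
      forall x, countable (F `&` [set f | f x != 0]) &
      forall x y, (forall f, F f -> f x = f y) -> p S x = p S y].

Lemma coordinatized_countable S : countable S -> coordinatized S.
Proof.
move=> cS; have [F hF] := choice rsk_countable_separating.
exists (\bigcup_(s in gen S) F s); split.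
- by move=> f [s _ Ff]; have [_ h _] := hF s; exact: h.
- move=> x; apply: countable_sub (@subIsetl _ _ _) _.
  by apply: bigcup_countable => [|s _]; [exact: gen_countable|case: (hF s)].
- move=> x y e; apply: (dretract_eq hK sk full (gen_directed S)) => s Ss.
  by have [_ _ h] := hF s; apply: h => f Ff; apply: e; exists s.
Qed.

Variables (lt : G -> G -> Prop).
Hypotheses (lt_wf : well_founded lt)
  (lt_trans : forall x y z, lt x y -> lt y z -> lt x z)
  (lt_total : forall x y, [\/ lt x y, x = y | lt y x]).

Definition le_wo x y := x = y \/ lt x y.

(** Fix a labelling [i] of [S]. The chain of directed sets consists of the sets
generated by the elements labelled below [v], or up to [v]. *)
Section Step.
Variables (S : set G) (i : G -> G).

Let Si (I : set G) := S `&` i @^-1` I.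
Let below v := Si [set u | lt u v].
Let upto v := Si [set u | le_wo u v].

(** The chain is continuous: an element of the generated set uses finitely many
generators, one of which has the largest label. *)
Lemma gen_upto (I : set G) s : gen (Si I) s ->
  gen set0 s \/ exists u, [/\ I u, (i @` S) u & gen (upto u) s].
Proof.
elim=> [|{}s [Ss Is]|{}s t _ + _ +].
- by left; exact: gen_base.
- right; exists (i s); split=> //.
  by apply: gen_in; split=> //; left.
- have mono u v : lt u v -> gen (upto u) `<=` gen (upto v).
    move=> uv; apply: gen_mono => w [Sw wu]; split=> //; right.
    by case: wu => [->//|wu]; exact: lt_trans uv.
  have mono0 u : gen set0 `<=` gen (upto u) by exact: gen_mono.
  move=> [s0|[u [Iu Su us]]] [t0|[v [Iv Sv vt]]].
  + by left; exact: gen_ub.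
  + by right; exists v; split=> //; apply: gen_ub => //; exact: mono0.
  + by right; exists u; split=> //; apply: gen_ub => //; exact: mono0.
  + have [uv|uv|vu] := lt_total u v.
    * by right; exists v; split=> //; apply: gen_ub => //; exact: mono us.
    * by right; exists v; split=> //; apply: gen_ub => //; rewrite -uv.
    * by right; exists u; split=> //; apply: gen_ub => //; exact: mono vt.
Qed.

Let jumps x := [set v | (i @` S) v /\ p (upto v) x <> p (below v) x].

(** Let [y] be the image of [x] under the retraction attached to the labels in
[I]. By countable tightness [y] is in the hull of countably many indices, which
appear at labels [w n] of [I]. A label of [I] above all [w n] does not move
[x], because [y] is already fixed before it; so all jumps of [I] are at or
below some [w n]. *)
Lemma countable_jumps_down x (I : set G) :
  (forall u v, I v -> lt u v -> I u) ->
  (forall v, I v -> countable (jumps x `&` [set u | le_wo u v])) ->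
  countable (jumps x `&` I).
Proof.
move=> Idown Ic.
have [c cI hc] := hull_countable hK sk full (pP (Si I) x).1.
have /choice[w hw] n : exists w, (I w /\ gen (upto w) (c n)) \/ gen set0 (c n).
  by have [|[u [? _ ?]]] := gen_upto (cI n); [exists base; right|exists u; left].
pose J n := jumps x `&` [set u | I (w n) /\ le_wo u (w n)].
apply: (@countable_sub _ _ (\bigcup_n J n)); last first.
  apply: bigcup_countable => // n _.
  have [Iw|nIw] := pselect (I (w n)).
    by apply: countable_sub (Ic _ Iw) => v [? []].
  by apply: (@countable_sub _ _ set0); [move=> v [_ []]|exact: countable0].
move=> v [Jv Iv]; apply: contrapT => nv; apply: Jv.2.
have cv n : gen (below v) (c n).
  have [[Iw wc]|] := hw n; last exact: gen_mono.
  have [wv|wv|vw] := lt_total (w n) v.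
  - apply: gen_mono wc => s [Ss sw]; split=> //=.
    by case: sw => [->//|sw]; exact: lt_trans wv.
  - by case: nv; exists n => //; split=> //; split=> //; left.
  - by case: nv; exists n => //; split=> //; split=> //; right.
have below_upto : gen (below v) `<=` gen (upto v).
  by apply: gen_mono => s [Ss sv]; split=> //; right.
have upto_I : gen (upto v) `<=` gen (Si I).
  by apply: gen_mono => s [Ss sv]; split=> //; case: sv => [|/(Idown _ _ Iv)//] /= ->.
have hb : hull r (gen (below v)) (p (Si I) x).
  by apply: hull_mono hc => _ [n _ <-].
have sub S' : gen S' `<=` gen (Si I) -> gen (below v) `<=` gen S' ->
    p S' x = p (Si I) x.
  move=> S'I bS'; rewrite /p -(dretract_lower hK sk full x (gen_directed _) (gen_directed _) S'I).
  by apply: (dretract_fix hK sk full (gen_directed _)); exact: hull_mono hb.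
by rewrite (sub (upto v)) ?(sub (below v)) //; exact: subset_trans upto_I.
Qed.

Lemma countable_jumps x : countable (jumps x).
Proof.
rewrite -[jumps x]setIT; apply: countable_jumps_down => // v _.
elim: (lt_wf v) => {}v _ IH.
apply: (@countable_sub _ _ ((jumps x `&` [set u | lt u v]) `|` [set v])).
  by move=> u [? [->|]]; [right|left].
apply: countable_setU; last exact: countable1.
by apply: countable_jumps_down => // u w wv uw; exact: lt_trans wv.
Qed.

Let jump_fun v (f : K -> R) (b : bool) x :=
  Num.max 0 ((-1) ^+ b * (f (p (upto v) x) - f (p (below v) x))).

(** Positive and negative parts of the differences along the chain. At a point
[x] they vanish except at the countably many jumps of [x]. Conversely, if all
of them agree on [x] and [y], then by induction along the chain no retraction
of the chain separates [x] from [y]. *)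
Lemma coordinatized_step : (forall s, S s -> coordinatized (upto (i s))) -> coordinatized S.
Proof.
move=> hS.
have [F0 [F0u F0c F0e]] : coordinatized set0 by apply: coordinatized_countable; exact: countable0.
have /choice[F hF] v : exists F : set (K -> R), (i @` S) v ->
  [/\ F `<=` continuous_unit,
      forall x, countable (F `&` [set f | f x != 0]) &
      forall x y, (forall f, F f -> f x = f y) -> p (upto v) x = p (upto v) y].
  have [[s Ss <-]|nv] := pselect ((i @` S) v); last by exists set0.
  by have [F] := hS _ Ss; exists F.
pose FF v : set (K -> R) := [set jump_fun v fb.1 fb.2 | fb in F v `*` [set: bool]].
have pc S' : continuous (p S') by exact: (dretract_cont hK sk full (gen_directed S')).
exists (F0 `|` \bigcup_(v in i @` S) FF v); split.
- move=> f [/F0u//|[v Sv [[g b] [/= Fg _] <-]]].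
  have [/(_ _ Fg)[gc g01] _ _] := hF _ Sv; split.
    apply: max_fun_continuous => [x|x]; first exact: cvg_cst.
    apply: cvgM; first exact: cvg_cst.
    by apply: cvgB; apply: continuous_comp; [exact: pc|exact: gc|exact: pc|exact: gc].
  move=> x; rewrite /jump_fun le_max lexx /= ge_max ler01 /=.
  have := g01 (p (upto v) x); have := g01 (p (below v) x).
  by case: b; rewrite ?expr0 ?expr1; lra.
- move=> x; apply: (@countable_sub _ _ ((F0 `&` [set f | f x != 0]) `|`
    \bigcup_(v in jumps x) [set jump_fun v fb.1 fb.2 | fb in
      ((F v `&` [set f | f (p (upto v) x) != 0]) `|`
       (F v `&` [set f | f (p (below v) x) != 0])) `*` [set: bool]])).
    move=> f [[F0f|[v Sv [[g b] [/= Fg _] <-]]] fx]; first by left.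
    right; exists v.
      split=> // e; move/eqP: fx; apply.
      by rewrite /jump_fun e subrr mulr0 maxxx.
    exists (g, b) => //; split=> //=.
    have [e1|n1] := eqVneq (g (p (upto v) x)) 0; last by left.
    have [e2|n2] := eqVneq (g (p (below v) x)) 0; last by right.
    by move/eqP: fx; case; rewrite /jump_fun e1 e2 subrr mulr0 maxxx.
  apply: countable_setU => //; apply: bigcup_countable.
    exact: countable_jumps.
  move=> v [Sv _]; apply: countable_image; apply: countableX => //.
  by have [_ h _] := hF _ Sv; apply: countable_setU.
- move=> x y e.
  have e0 s : gen set0 s -> r s x = r s y.
    move=> s0; have [_ <-//] := pP set0 x; have [_ <-//] := pP set0 y.
    by rewrite (F0e x y) // => f Ff; apply: e; left.
  have agree (I : set G) :
      (forall v, I v -> (i @` S) v -> p (upto v) x = p (upto v) y) ->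
      p (Si I) x = p (Si I) y.
    move=> hI; apply: (dretract_eq hK sk full (gen_directed _)) => s.
    move=> /gen_upto[/e0//|[u [Iu Su us]]].
    have [_ <-//] := pP (upto u) x; have [_ <-//] := pP (upto u) y.
    by rewrite hI.
  have -> : S = Si setT by apply/seteqP; split=> // s [].
  apply: (agree setT) => v _; elim: (lt_wf v) => {}v _ IH Sv.
  have eb : p (below v) x = p (below v) y by exact: agree.
  have [_ _ hv] := hF _ Sv.
  have idem z : p (upto v) (p (upto v) z) = p (upto v) z.
    exact: (dretract_lower hK sk full z (gen_directed _) (gen_directed _)).
  rewrite -(idem x) -(idem y); apply: hv => f Ff.
  have ejf b : jump_fun v f b x = jump_fun v f b y.
    by apply: e; right; exists v => //; exists (f, b).
  move: (ejf true) (ejf false); rewrite /jump_fun -eb expr0 expr1.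
  set a := f _; set b := f _; set c := f _.
  by rewrite /Num.max; do ![case: ifPn]; rewrite -?leNgt; lra.
Qed.

End Step.

(** Induction on the length of the labelling. If uncountably many labels precede
[v], the labels up to [v] can be moved injectively strictly below [v]; this
replaces the choice of a labelling of least length, and makes the induction
hypothesis apply to all initial parts. *)
Lemma coordinatized_initial v (S : set G) (i : G -> G) :
  {in S &, injective i} -> (forall s, S s -> le_wo (i s) v) -> coordinatized S.
Proof.
elim: (lt_wf v) S i => {}v _ IH S i iinj iv.
have [cv|ncv] := pselect (countable [set u | lt u v]).
  apply: coordinatized_countable; have /countable_injP[f finj] :
      countable ([set u | lt u v] `|` [set v]).
    by apply: countable_setU => //; exact: countable1.
  apply/countable_injP; exists (f \o i) => s t Ss St /= /finj fe.
  apply: iinj => //; apply: fe; rewrite inE.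
    by have [|] := iv s (set_mem Ss); [right|left].
  by have [|] := iv t (set_mem St); [right|left].
have /infiniteP/card_leP[g] : infinite_set [set u | lt u v].
  by apply: contra_not ncv; exact: finite_set_countable.
pose a n := val (g (SigSub (mem_set (I : [set: nat] n)))).
have av n : lt (a n) v by exact: set_valP (g _).
have ainj : injective a.
  by move=> m n /val_inj /('inj_g (mem_set I) (mem_set I)) [].
have lt_irr u : ~ lt u u by elim: (lt_wf u) => w _ IHw ww; exact: (IHw w ww ww).
have [j [jinj jv]] : exists j : G -> G, injective j /\
    forall u, le_wo u v -> lt (j u) v.
  (* a shift along the sequence [v, a 0, a 1, ...] *)
  pose P u n := (n = 0%N /\ u = v) \/ (exists2 m, n = m.+1 & u = a m).
  have Pfun u n n' : P u n -> P u n' -> n = n'.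
    move=> [[-> ->]|[m -> ->]] [[-> e]|[m' -> e]] //.
    - by case: (@lt_irr v); rewrite {1}e.
    - by case: (@lt_irr v); rewrite -{1}e.
    - by rewrite (ainj _ _ e).
  have Pinj u u' n : P u n -> P u' n -> u = u'.
    by move=> [[-> ->]|[m -> ->]] [[// _ ->]|[m' // [->] ->]].
  have /choice[j hj] u : exists w, (exists2 n, P u n & w = a n) \/
      ((forall n, ~ P u n) /\ w = u).
    have [[n Pn]|nP] := pselect (exists n, P u n).
      by exists (a n); left; exists n.
    by exists u; right; split=> // n Pn; apply: nP; exists n.
  exists j; split=> [u u' ju|u uv].
    have [[n Pn e]|[nP e]] := hj u; have [[n' Pn' e']|[nP' e']] := hj u'.
    - by move: ju; rewrite e e' => /ainj en; apply: Pinj Pn _; rewrite en.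
    - by case: (nP' n.+1); right; exists n => //; rewrite -e' -ju e.
    - by case: (nP n'.+1); right; exists n' => //; rewrite -e ju e'.
    - by rewrite -e ju e'.
  have [[n _ ->]//|[nP ->]] := hj u.
  by case: uv => // uv; case: (nP 0%N); left.
apply: (@coordinatized_step S (j \o i)) => s Ss.
apply: (IH (j (i s)) (jv _ (iv _ Ss)) _ (j \o i)) => [t u|t []//].
by rewrite !inE => -[St _] [Su _] /jinj; apply: iinj; rewrite inE.
Qed.

Lemma coordinatized_all : (forall S : set G, coordinatized S).
Proof.
by move=> S; apply: (@coordinatized_step S id) => s Ss; apply: (@coordinatized_initial s _ id) => [t u|t []].
Qed.

End PointCountable.

Lemma full_skeleton_corson (R : realType) (K : topologicalType)
    (d : Order.disp_t) (G : porderType d) (r : G -> K -> K) :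
  compact_hausdorff K -> r_skeleton R r -> (forall x, skeleton_core r x) ->
  corson R K.
Proof.
move=> hK sk full.
have [[base] _] := rsk_directed sk.
have /choice[ub hub] : forall st : G * G, exists u, (st.1 <= u)%O /\ (st.2 <= u)%O.
  by move=> st; exact: rsk_ub sk _ _.
have [lt [lt_wf lt_trans lt_total]] := well_order_exists G.
have [F [Fu Fc Fe]] :=
  coordinatized_all hK sk full base hub lt_wf lt_trans lt_total [set: G].
have Finj x y : (forall f, F f -> f x = f y) -> x = y.
  move=> /Fe; rewrite !(dretract_fix hK sk full (gen_directed _ hub _)) //.
    by have [s] := full y; apply: hull_fix; exact: gen_in.
  by have [s] := full x; apply: hull_fix; exact: gen_in.
pose h (x : K) : {ptws (K -> R) -> R} :=
  fun f => if `[< F f >] then f x else 0.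
exists (K -> R), h; split.
- apply: compact_embedding => //.
  + exact: (@hausdorff_product _ (fun=> R) (fun=> @Rhausdorff R)).
  + apply: ptws_continuous => f; rewrite /h; case: asboolP => [/Fu[]//|_] x.
    exact: cvg_cst.
  + move=> x y exy; apply: Finj => f Ff.
    by have := congr1 (@^~ f) exy; rewrite /h /= asboolT.
- move=> x f; rewrite in_itv /= /h; case: asboolP => [Ff|_].
    by have [_ ->] := Fu _ Ff.
  by rewrite lexx ler01.
- move=> _ [x _ <-]; apply: countable_sub (Fc x) => f /=.
  by rewrite /h; case: asboolP => [//|_]; rewrite eqxx.
Qed.

(** * Quotients and the points they force into the induced set *)

(** Saturations of closed sets are closed, as projections of compact sets, so
that disjoint classes have disjoint saturated open neighbourhoods. *)
Lemma quotient_space (R : realType) (K : topologicalType) (e : K -> K -> Prop) :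
  compact_hausdorff K ->
  (forall x, e x x) -> (forall x y, e x y -> e y x) ->
  (forall x y z, e x y -> e y z -> e x z) ->
  closed [set xy : K * K | e xy.1 xy.2] ->
  exists (L : topologicalType) (q : K -> L), [/\ compact_hausdorff L,
    continuous q, set_surj [set: K] [set: L] q & forall x y, q x = q y <-> e x y].
Proof.
move=> hK er es et ec.
pose b : rel K := fun x y => `[< e x y >].
have br : reflexive b by move=> x; apply/asboolP; exact: er.
have bs : symmetric b by move=> x y; apply/asboolP/asboolP; exact: es.
have bt : transitive b.
  by move=> y x z /asboolP xy /asboolP yz; apply/asboolP; exact: et yz.
pose E := @EquivRelPack K b (EquivClass br bs bt).
pose L := quotient_topology {eq_quot E}%qT.
pose q : K -> L := \pi_L%qT.
have qc : continuous q by exact: pi_continuous.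
have qs (y : L) : exists x, q x = y by exists (repr y); exact: reprK.
have qe x y : q x = q y <-> e x y.
  split=> [xy|xy]; first by apply/asboolP; exact/(@eqmodP _ E).
  by apply/(@eqmodP _ E)/asboolP.
exists L, q; split=> //; last first.
  by move=> y _; have [x <-] := qs y; exists x.
split.
  have -> : [set: L] = q @` [set: K].
    by apply/seteqP; split=> // y _; have [x <-] := qs y; exists x.
  apply: continuous_compact hK.1; exact: continuous_subspaceT.
have sat_closed F : closed F -> closed [set y | exists2 x, F x & e x y].
  move=> Fc.
  have -> : [set y | exists2 x, F x & e x y] =
      snd @` ([set xy : K * K | e xy.1 xy.2] `&` fst @^-1` F).
    apply/seteqP; split=> [y [x Fx xy]|_ [[x y] [/= xy Fx] <-]]; last by exists x.
    by exists (x, y).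
  apply: compact_closed hK.2 _; apply: continuous_compact.
    by apply: continuous_subspaceT => x; exact: cvg_snd.
  apply: (subclosed_compact _ (compact_setX hK.1 hK.1)).
    apply: closedI => //; apply: closed_comp Fc => x _; exact: cvg_fst.
  by [].
have class_closed x : closed [set y | e x y].
  rewrite (_ : [set y | _] = [set y | exists2 z, [set x] z & e z y]); last first.
    by apply/seteqP; split=> [y xy|y [_ ->]//]; exists x.
  by apply: sat_closed; exact: hausdorff_closed_point hK.2.
rewrite open_hausdorff => x' y'; have [x <-] := qs x'; have [y <-] := qs y'.
move=> /eqP nxy.
have disj : [set z | e x z] `&` [set z | e y z] = set0.
  apply/seteqP; split=> // z [xz yz]; case: nxy; apply/qe/(et _ _ _ xz)/es/yz.
have /(@normal_openP R) := compact_normal hK.2 hK.1.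
move=> /(_ _ _ (class_closed x) (class_closed y) disj) [U [V [Uo Vo xU yV UV]]].
pose sat W := [set z | forall w, e z w -> W w].
have sat_open W : open W -> open (q @` sat W).
  move=> Wo; rewrite /open /= /quotient_open.
  rewrite (_ : _ @^-1` _ = ~` [set y | exists2 x, (~` W) x & e x y]).
    by apply: closed_openC; apply: sat_closed; exact: open_closedC.
  apply/seteqP; split=> [z [w ww /qe wz] [v nWv vz]|z nz].
    by apply: nWv; apply: ww; apply: et wz _; exact: es.
  exists z => // w zw; apply: contrapT => nWw; apply: nz; exists w => //.
  exact: es.
exists (q @` sat U, q @` sat V) => /=.
  have xs : (q @` sat U) (q x) by exists x => // w /xU.
  have ys : (q @` sat V) (q y) by exists y => // w /yV.
  by rewrite !in_setE.
split; [exact: sat_open|exact: sat_open|].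
apply/eqP/seteqP; split=> // _ [[z zU <-] [w wV /qe wz]].
suff : (U `&` V) z by rewrite UV.
by split; [exact: zU|exact: wV].
Qed.

(** The images of small closed neighbourhoods of [z] and [w] are the two closed
sets required by [skeleton_forcing]; that they meet only at [q z] is ensured by
[z] being isolated among the points which [q] glues. *)
Lemma glued_point_core (R : realType) (K L : topologicalType) (q : K -> L)
    (d : Order.disp_t) (G : porderType d) (r : G -> L -> L) (z w : K) :
  compact_hausdorff K -> compact_hausdorff L -> continuous q ->
  set_surj [set: K] [set: L] q -> r_skeleton R r ->
  z <> w -> q z = q w -> (forall x, q x = q z -> x = z \/ x = w) ->
  (exists2 V, nbhs z V & forall v x, V v -> q v = q x -> v = x \/ v = z) ->
  closure (~` [set z]) z -> closure (~` [set w]) w ->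
  skeleton_core r (q z).
Proof.
move=> hK hL qc qs sk zw qzw fib [V zV Viso] zacc wacc.
have [A [Q [Ac Qc zA wQ AQ]]] := disjoint_closed_nbhs hK zw.
have [P [Pc zP PV]] := closed_nbhs_sub hK (filterI zV zA).
have PQ0 v : P v -> Q v -> False by move=> /PV[_ /AQ].
have qclosed C : closed C -> closed (q @` C).
  exact: compact_closed_map hK.1 hL.2 qc.
have PQ v u : P v -> Q u -> q v = q u -> v = z.
  move=> Pv Qu /(Viso _ _ (PV _ Pv).1)[e|//].
  by case: (PQ0 v) => //; rewrite e.
apply: (@skeleton_forcing _ _ hL _ _ _ sk (q @` P) (q @` Q)).
- exact: qclosed.
- exact: qclosed.
- by move=> _ [[v Pv <-] [u Qu /esym /(PQ _ _ Pv Qu) ->]].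
- have Co : closed (q @` (~` (P^° `|` Q^°))).
    by apply: qclosed; apply: open_closedC; apply: openU; exact: open_interior.
  rewrite nbhsE; exists (~` (q @` (~` (P^° `|` Q^°)))); first split.
  + exact: closed_openC.
  + move=> [x nx /fib[e|e]]; apply: nx; rewrite e.
      by left; exact: nbhs_singleton (nbhs_interior zP).
    by right; exact: nbhs_singleton (nbhs_interior wQ).
  + move=> y ny; have [x _ xy] := qs y I.
    have [] : (P^° `|` Q^°) x by apply: contrapT => nx; apply: ny; exists x.
      by move=> /interior_subset Px; left; exists x.
    by move=> /interior_subset Qx; right; exists x.
- move=> U; rewrite qzw => wU.
  have [y [yw [Qy Uy]]] := wacc _ (filterI wQ (qc _ _ wU)).
  exists (q y); split=> // -[v Pv e].
  have vz := PQ _ _ Pv Qy e; rewrite vz in e.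
  have [yz|//] := fib _ (esym e).
  by apply: (PQ0 y) => //; rewrite yz; exact: nbhs_singleton zP.
- move=> U zU.
  have [y [yz [Py Uy]]] := zacc _ (filterI zP (qc _ _ zU)).
  by exists (q y); split=> // -[u Qu e]; apply: yz; exact: PQ Py Qu (esym e).
Qed.

(** * A skeleton that is not full gives an image without skeleton *)

Section OutsideCore.
Variables (R : realType) (K : topologicalType).
Hypothesis hK : compact_hausdorff K.
Variables (d : Order.disp_t) (G : porderType d) (r : G -> K -> K).
Hypothesis sk : r_skeleton R r.
Variable b : K.
Hypothesis nb : ~ skeleton_core r b.

Lemma outside_core_moves s : exists t, (s < t)%O /\ r t b <> r s b.
Proof.
have nsb : b <> r s b by move=> e; apply: nb; exists s.
have /(rsk_near sk)[s0 hs0] : nbhs b (~` [set r s b]).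
  by apply: open_nbhs_nbhs; split=> //; exact/closed_openC/hausdorff_closed_point/hK.2.
have [t [st s0t]] := rsk_ub sk s s0.
have rts := hs0 _ s0t; exists t; split=> //.
by rewrite lt_neqAle st andbT; apply/eqP => e; apply: rts; rewrite e.
Qed.

Lemma rsk_moved s t v : (s <= t)%O -> (t <= v)%O -> r s b <> r t b -> r s b <> r v b.
Proof.
move=> st tv nst e; apply: nst.
by rewrite -(rsk_lower sk b tv) -e (rsk_upper sk).
Qed.

(** The supremum of an increasing sequence of indices which move [b]: the value
[r t b] is then a limit of points different from it. *)
Lemma outside_core_limit s : exists t,
  [/\ (s < t)%O, r s b <> r t b & closure (~` [set r t b]) (r t b)].
Proof.
have /choice[g hg] := outside_core_moves.
pose u n := iter n g s.
have uS n : (u n < u n.+1)%O by have [] := hg (u n).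
have [t [tub _] tl] := rsk_sup sk uS.
have ut n : (u n <= t)%O by apply: tub; exists n.
have une n : r (u n) b <> r t b.
  apply: (rsk_moved (ltW (uS n)) (ut _)); apply/nesym; exact: (hg (u n)).2.
exists t; split; first exact: lt_le_trans (uS 0%N) (ut 1%N).
  exact: (une 0%N).
apply: (@closed_cvg _ _ \oo _ _ _ (@closed_closure _ _) _ _ (tl b)).
by apply: nearW => n; apply: subset_closure; exact: une.
Qed.

Lemma countable_bound (A : set G) : countable A -> exists t, forall a, A a -> (a <= t)%O.
Proof.
move=> cA; have [A0|nA] := pselect (A !=set0); last first.
  by have [[t] _] := rsk_directed sk; exists t => a Aa; case: nA; exists a.
have [e _ eA] := countable_enum cA A0.
have Tdir : directed [set: G].
  split; first by have [[t] _] := rsk_directed sk; exists t.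
  by move=> s t _ _; have [u [? ?]] := rsk_ub sk s t; exists u.
have [u [_ u1 eu]] := directed_chain Tdir (fun n => I : setT (e n)).
have [t [_ [ut _]]] := rsk_sup_le sk u1.
by exists t => a /eA[n <-]; exact: le_trans (eu n) (ut n).
Qed.

Hypothesis images : forall L : topologicalType,
  continuous_image K L -> has_r_skeleton R L.

(** In the proof, [s : W -> G] is a chain of length omega_1 and [h a] bounds the
two indices used at stage [a]. Everything built before stage [a] is fixed by
[r (s a)], while everything built after it has the value [x' a] under
[r (h a)]; these two facts separate the selected points from each other. *)
Lemma outside_core_absurd : False.
Proof.
have [W [lt [[w0] wf tr tot [ctb bdd]]]] := omega1_exists.
have /choice[nx hnx] := outside_core_limit.
have nxl s : (s <= nx s)%O by have [/ltW] := hnx s.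
have /choice[Bd hBd] (A : set G) : exists t, countable A -> forall a, A a -> (a <= t)%O.
  have [cA|ncA] := pselect (countable A).
    by have [t] := countable_bound cA; exists t.
  by have [[t] _] := rsk_directed sk; exists t.
have [[base] _] := rsk_directed sk.
pose t0 := nx (nx base); pose c := r (nx base) b.
(* [s] is defined by recursion along [W]; countable initial segments provide
   the upper bounds *)
have [s [s0s ss]] : exists s : W -> G, (forall a, t0 <= s a)%O /\
    (forall a' a, lt a' a -> (nx (nx (s a')) <= s a)%O).
  pose step (a : W) (rec : forall a', lt a' a -> G) : G :=
    Bd ([set t0] `|` [set t | exists a' (h : lt a' a), t = nx (nx (rec a' h))]).
  pose s := Fix wf (fun=> G) step.
  have sE a : s a = Bd ([set t0] `|` (nx \o nx \o s) @` [set a' | lt a' a]).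
    rewrite /s Fix_eq => [|{}a f g fg].
      rewrite /step; congr (Bd (_ `|` _)); apply/seteqP; split.
        by move=> _ [a' [h ->]]; exists a'.
      by move=> _ [a' h <-]; exists a', h.
    by congr (step a); do 2! apply: functional_extensionality_dep => ?.
  have cs a : countable ([set t0] `|` (nx \o nx \o s) @` [set a' | lt a' a]).
    by apply: countable_setU; [exact: countable1|exact: countable_image].
  exists s; split=> [a|a' a aa]; rewrite (sE a); apply: (hBd _ (cs a)).
    by left.
  by right; exists a'.
pose h a := nx (nx (s a)).
pose x a := r (nx (s a)) b; pose x' a := r (h a) b.
have sh a : (s a <= h a)%O by exact: le_trans (nxl _) (nxl _).
(* points of earlier stages are fixed by [r (s a)], those of later ones are not *)
have fx a' a : lt a' a -> r (s a) (x a') = x a'.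
  move=> aa; apply: (rsk_upper sk); apply: le_trans (ss _ _ aa); exact: nxl.
have fx' a' a : lt a' a -> r (s a) (x' a') = x' a'.
  by move=> aa; apply: (rsk_upper sk); exact: ss.
have fc a : r (s a) c = c.
  by apply: (rsk_upper sk); apply: le_trans (s0s a); exact: nxl.
have nfx a : r (s a) (x a) <> x a.
  by rewrite (rsk_lower sk) //; have [_] := hnx (s a).
have sbh a : r (s a) b <> r (h a) b.
  by apply: (rsk_moved (nxl _) (nxl _)); have [_] := hnx (s a).
have nfx' a : r (s a) (x' a) <> x' a by rewrite (rsk_lower sk).
have xx' a : x a <> x' a by have [_] := hnx (nx (s a)).
have nc : c <> r t0 b by have [_] := hnx (nx base).
have rc : r t0 c = c by apply: (rsk_upper sk); exact: nxl.
have ux a a' : lt a a' -> r (h a) (x a') = x' a.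
  by move=> aa; apply: (rsk_lower sk); apply: le_trans (ss _ _ aa) _; exact: nxl.
have ux' a a' : lt a a' -> r (h a) (x' a') = x' a.
  by move=> aa; apply: (rsk_lower sk); apply: le_trans (ss _ _ aa) _; exact: sh.
have ucx a : r t0 (x a) = r t0 b.
  by apply: (rsk_lower sk); apply: le_trans (s0s a) _; exact: nxl.
have ucx' a : r t0 (x' a) = r t0 b.
  by apply: (rsk_lower sk); apply: le_trans (s0s a) _; exact: sh.
pose Ft : set_system K := filter_from [set: W] (fun a => x @` [set a' | lt a a']).
have ltub a a' : exists a'', lt a a'' /\ lt a' a''.
  have [a'' ha] := bdd (fun n => if n is 0%N then a else a').
  by exists a''; split; [exact: (ha 0%N)|exact: (ha 1%N)].
have FtF : ProperFilter Ft.
  apply: filter_from_proper => [|a _]; last first.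
    by have [a' [aa' _]] := ltub a a; exists (x a'), a'.
  apply: filter_from_filter; first by exists w0.
  move=> a a' _ _; have [a'' [aa aa']] := ltub a a'; exists a'' => //.
  by move=> _ [v /= av <-]; split; exists v => //=; exact: tr av.
(* [b'] is a limit of the [x a] at the end of the chain *)
have [b' cb'] := cluster_exists hK FtF.
have ub' a : r (h a) b' = x' a.
  apply: (@cluster_closed _ _ [set v | r (h a) v = x' a] _ _ _ cb').
    apply: (closed_eqfun hK.2); [exact: rsk_cont sk _|by move=> v; exact: cvg_cst].
  by exists a => // _ [a' aa' <-]; exact: ux.
have ucb' : r t0 b' = r t0 b.
  have t0h : (t0 <= h w0)%O by exact: le_trans (s0s w0) (sh w0).
  by rewrite -(rsk_lower sk b' t0h) ub' /x' (rsk_lower sk).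
have nfb' a : r (s a) b' <> b'.
  move=> e; have e' := ub' a; rewrite (rsk_fix_le sk (sh a) e) in e'.
  by apply: (nfx' a); rewrite -e'.
(* the pairs to be glued; no point occurs in two of them *)
pose pr y z := (exists a, y = x a /\ z = x' a) \/ (y = c /\ z = b').
have b'x a : b' <> x a.
  by have [a' [aa' _]] := ltub a a => e; apply: (nfb' a'); rewrite e fx.
have b'x' a : b' <> x' a.
  by have [a' [aa' _]] := ltub a a => e; apply: (nfb' a'); rewrite e fx'.
have b'c : b' <> c by move=> e; apply: (nfb' w0); rewrite e fc.
have cx a : c <> x a by move=> e; apply: (nfx a); rewrite -e fc.
have cx' a : c <> x' a by move=> e; apply: (nfx' a); rewrite -e fc.
have xinj a a' : x a = x a' -> a = a'.
  have [aa|//|aa] := tot a a' => e.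
    by case: (nfx a'); rewrite -e fx.
  by case: (nfx a); rewrite e fx.
have x'inj a a' : x' a = x' a' -> a = a'.
  have [aa|//|aa] := tot a a' => e.
    by case: (nfx' a'); rewrite -e fx'.
  by case: (nfx' a); rewrite e fx'.
have xnx' a a' : x a <> x' a'.
  have [aa|->|aa] := tot a a' => // e.
    by case: (nfx' a'); rewrite -e fx.
  by case: (nfx a); rewrite e fx'.
have prfun y z z' : pr y z -> pr y z' -> z = z'.
  move=> [[a [-> ->]]|[-> ->]] [[a' [e ->]]|[e ->]] //.
  - by rewrite (xinj _ _ e).
  - by case: (cx a).
  - by case: (cx a').
have prinj y y' z : pr y z -> pr y' z -> y = y'.
  move=> [[a [-> ->]]|[-> ->]] [[a' [-> e]]|[-> e]] //.
  - by rewrite (x'inj _ _ e).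
  - by case: (b'x' a).
  - by case: (b'x' a').
have prchain y z v : pr y z -> pr z v -> False.
  move=> [[a [_ ->]]|[_ ->]] [[a' [e _]]|[e _]].
  - by case: (xnx' a' a).
  - by case: (cx' a).
  - by case: (b'x a').
  - by case: b'c.
pose e y z := [\/ y = z, pr y z | pr z y].
have er y : e y y by constructor 1.
have es y z : e y z -> e z y.
  by case=> [->|?|?]; [constructor 1|constructor 3|constructor 2].
have et y z v : e y z -> e z v -> e y v.
  move=> [->//|yz|zy] [<-|zv|vz].
  - by constructor 2.
  - by case: (prchain _ _ _ yz zv).
  - by rewrite (prinj _ _ _ yz vz); constructor 1.
  - by constructor 3.
  - by rewrite (prfun _ _ _ zy zv); constructor 1.
  - by case: (prchain _ _ _ vz zy).
pose PI (I : set W) : set (K * K) := [set (x a, x' a) | a in I].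
have fstc : continuous (@fst K K) by move=> yz; exact: cvg_fst.
have sndc : continuous (@snd K K) by move=> yz; exact: cvg_snd.
have pt (y z : K) : closed [set yz : K * K | yz.1 = y /\ yz.2 = z].
  apply: (@closedI _ (fst @^-1` [set y]) (snd @^-1` [set z])).
    by apply: (@preimage_closed _ _ fst) => [yz _|]; [exact: fstc|exact: hausdorff_closed_point hK.2].
  by apply: (@preimage_closed _ _ snd) => [yz _|]; [exact: sndc|exact: hausdorff_closed_point hK.2].
have PIclosed yz : closure (PI setT) yz -> e yz.1 yz.2.
  case: yz => y y' /= cl; apply: contrapT => ney.
  have [C [C' [Cc C'c yC y'C' CC']]] : exists C C', [/\ closed C, closed C',
      nbhs y C, nbhs y' C' & forall v, C v -> ~ C' v].
    by apply: disjoint_closed_nbhs => // yy'; apply: ney; constructor 1.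
  have PIpick I : closure (PI I) (y, y') -> exists a, [/\ I a, C (x a) & C' (x' a)].
    have yyC : nbhs (y, y') (C `*` C') by exists (C, C').
    by move=> /(_ _ yyC)[_ [[a Ia <-] [/= ? ?]]]; exists a.
  have PIU I J J' : I `<=` J `|` J' -> closure (PI I) (y, y') ->
      closure (PI J) (y, y') \/ closure (PI J') (y, y').
    move=> IJ /(closureS (image_subset _ IJ)); rewrite image_setU closureU.
    by case; [left|right].
  (* A limit [(y, y')] of pairs, not itself a pair, is approached along a limit
     stage or along the end of [W]: [J] is the set of earlier stages. An
     increasing sequence of stages then gives both coordinates the same limit
     [r t b]. *)
  pose le a a' := a = a' \/ lt a a'.
  pose J := [set g | ~ closure (PI [set a | le a g]) (y, y')].
  have clJ : closure (PI J) (y, y').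
    apply: contrapT => ncl.
    have JT g : J g.
      elim: (wf g) => {}g _ IH clg; apply: ncl.
      have [|//|] := PIU _ J [set g] _ clg.
        by move=> a [->|/IH]; [right|left].
      rewrite /PI image_set1 => clg1.
      have [yg y'g] : y = x g /\ y' = x' g.
        apply: (pt (x g) (x' g) (y, y')); apply: closureS clg1.
        by move=> _ ->.
      by case: ney; constructor 2; left; exists g.
    by apply: ncl; apply: closureS cl; apply: image_subset => a _; exact: JT.
  have Jstep g : J g -> closure (PI [set a | J a /\ lt g a]) (y, y').
    move=> Jg; have [|//|//] := PIU _ [set a | le a g] [set a | J a /\ lt g a] _ clJ.
    move=> a Ja; have [ag|->|ga] := tot a g; first by left; right.
      by left; left.
    by right.
  have /choice[nxt hnxt] g : exists a, J g -> [/\ J a, lt g a, C (x a) & C' (x' a)].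
    have [Jg|nJg] := pselect (J g); last by exists g.
    by have [a [[Ja ga] ? ?]] := PIpick _ (Jstep _ Jg); exists a.
  have [a0 [Ja0 _ _]] := PIpick _ clJ.
  pose al n := iter n.+1 nxt a0.
  have Jal n : J (iter n nxt a0) by elim: n => //= n /hnxt[].
  have Cal n : C (x (al n)) by have [] := hnxt _ (Jal n).
  have C'al n : C' (x' (al n)) by have [] := hnxt _ (Jal n).
  have altS n : lt (al n) (al n.+1) by have [] := hnxt _ (Jal n.+1).
  have nxlt g : (g < nx g)%O by have [] := hnx g.
  have uS n : (nx (s (al n)) < nx (s (al n.+1)))%O.
    apply: lt_trans (nxlt _) _; apply: le_lt_trans (nxlt _).
    exact: ss (altS n).
  have vS n : (h (al n) < h (al n.+1))%O.
    apply: le_lt_trans (ss _ _ (altS n)) _.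
    exact: lt_trans (nxlt _) (nxlt _).
  have [t [tu tl] tc] := rsk_sup sk uS.
  have [t' [t'u t'l] t'c] := rsk_sup sk vS.
  have tt' : t = t'.
    apply: le_anti; apply/andP; split.
      apply: tl => _ [n _ <-]; apply: le_trans (nxl _) _.
      by apply: t'u; exists n.
    apply: t'l => _ [n _ <-]; apply: le_trans (ss _ _ (altS n)) _.
    apply: le_trans (nxl _) _; by apply: tu; exists n.+1.
  apply: (CC' (r t b)).
    by apply: (@closed_cvg _ _ \oo _ _ _ Cc _ _ (tc b)); apply: nearW => n; exact: Cal.
  rewrite tt'.
  by apply: (@closed_cvg _ _ \oo _ _ _ C'c _ _ (t'c b)); apply: nearW => n; exact: C'al.
have ec : closed [set yz : K * K | e yz.1 yz.2].
  rewrite (_ : [set yz | _] = [set yz : K * K | yz.1 = yz.2] `|`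
    (closure (PI setT) `|` (fun yz => (yz.2, yz.1)) @^-1` closure (PI setT)) `|`
    ([set yz : K * K | yz.1 = c /\ yz.2 = b'] `|`
     [set yz : K * K | yz.1 = b' /\ yz.2 = c])).
    apply: closedU; last by apply: closedU; exact: pt.
    apply: closedU; first exact: (closed_eqfun hK.2 fstc sndc).
    apply: closedU; first exact: closed_closure.
    apply: (@preimage_closed _ _ (fun yz : K * K => (yz.2, yz.1))).
      by move=> yz _; apply: cvg_pair; [exact: sndc|exact: fstc].
    exact: closed_closure.
  apply/seteqP; split=> -[y z] /=.
    case=> [->|[[a [-> ->]]|[-> ->]]|[[a [-> ->]]|[-> ->]]].
    - by left; left.
    - by left; right; left; apply: subset_closure; exists a.
    - by right; left.
    - by left; right; right; apply: subset_closure; exists a.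
    - by right; right.
  case=> [[->|[/PIclosed //|/PIclosed /= /es //]]|[[-> ->]|[-> ->]]].
  - by constructor 1.
  - by constructor 2; right.
  - by constructor 3; right.
have [L [q [hL qc qs qe]]] := quotient_space R hK er es et ec.
have [dL [GL [rL skL]]] : has_r_skeleton R L by apply: images; split=> //; exists q.
have xacc a : closure (~` [set x a]) (x a) by have [] := hnx (s a).
have x'acc a : closure (~` [set x' a]) (x' a) by have [] := hnx (nx (s a)).
have cacc : closure (~` [set c]) c by have [] := hnx base.
have b'cl : closure (range x) b'.
  apply: (cluster_closed (@closed_closure _ _) _ cb').
  by exists w0 => // _ [a _ <-]; apply: subset_closure; exists a.
have b'acc : closure (~` [set b']) b'.
  by apply: closureS b'cl => _ [a _ <-] /esym; exact: b'x.
have fibre y z v : pr y z -> q v = q y -> v = y \/ v = z.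
  move=> yz /qe[->|vy|yv]; first by left.
    by case: (prchain _ _ _ vy yz).
  by right; exact: prfun yv yz.
(* the glued points are forced into the induced set of [L] *)
have corex a : skeleton_core rL (q (x a)).
  have pra : pr (x a) (x' a) by left; exists a.
  apply: (glued_point_core hK hL qc qs skL (w := x' a)) => //.
  - by apply/qe; constructor 2.
  - by move=> v; exact: fibre.
  exists ([set v | r (s a) v <> v] `&` [set v | r (h a) v <> x' a]).
    apply: open_nbhs_nbhs; split; last first.
      split; first exact: nfx.
      rewrite /=.
      have -> // : r (h a) (x a) = x a by apply: (rsk_upper sk); exact: nxl.
    apply: openI.
      apply: (@closed_openC _ [set v | r (s a) v = v]).
      exact: (rsk_fix_closed hK sk).
    apply: (@closed_openC _ [set v | r (h a) v = x' a]).
    by apply: (closed_eqfun hK.2); [exact: rsk_cont sk _|move=> v; exact: cvg_cst].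
  have sep v : r (s a) v <> v -> r (h a) v <> x' a ->
      (exists u, pr v u \/ pr u v) -> v = x a.
    move=> nv1 nv2 [u [[[a' [ev _]]|[ev _]]|[[a' [_ ev]]|[_ ev]]]].
    - rewrite ev in nv1 nv2 *.
      have [aa|->//|aa] := tot a' a; first by rewrite fx in nv1.
      by rewrite ux in nv2.
    - by rewrite ev fc in nv1.
    - rewrite ev in nv1 nv2; exfalso.
      have [aa|aa|aa] := tot a' a; first by rewrite fx' in nv1.
        by apply: nv2; rewrite aa (rsk_idem sk).
      by rewrite ux' in nv2.
    - by rewrite ev ub' in nv2.
  move=> v u [nv1 nv2] /qe[->|vu|uv]; first by left.
    by right; apply: sep => //; exists u; left.
  by right; apply: sep => //; exists u; right.
have corec : skeleton_core rL (q c).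
  have prc : pr c b' by right.
  apply: (glued_point_core hK hL qc qs skL (w := b')) => //.
  - exact/nesym.
  - by apply/qe; constructor 2.
  - by move=> v; exact: fibre.
  exists [set v | r t0 v <> r t0 b].
    apply: open_nbhs_nbhs; split; last by rewrite /= rc.
    apply: (@closed_openC _ [set v | r t0 v = r t0 b]).
    by apply: (closed_eqfun hK.2); [exact: rsk_cont sk _|move=> v; exact: cvg_cst].
  have sep v : r t0 v <> r t0 b -> (exists u, pr v u \/ pr u v) -> v = c.
    by move=> nv [u [[[a' [ev _]]|[//]]|[[a' [_ ev]]|[_ ev]]]]; case: nv; rewrite ev.
  move=> v u nv /qe[->|vu|uv]; first by left.
    by right; apply: sep => //; exists u; left.
  by right; apply: sep => //; exists u; right.
have [sL fixL] := corec.
have qcb : q c = q b' by apply/qe; constructor 2; right.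
have Mcl : closure [set q (x a) | a in [set: W]] (q c).
  rewrite qcb => U /(qc _) /b'cl [_ [[a _ <-] Ua]]; by exists (q (x a)).
have GLcof s' : exists2 t : GL, [set: GL] t & (s' <= t)%O by exists s'.
have Mcore : [set q (x a) | a in [set: W]] `<=` skeleton_core rL.
  by move=> _ [a _ <-].
have [t [m [sLt hm mt _]]] := skeleton_frechet_urysohn hL skL sL GLcof Mcore Mcl.
rewrite (rsk_fix_le skL sLt fixL) in mt.
have /choice[al hal] n : exists a, q (x a) = m n.
  by have [[a _ <-] _] := hm n; exists a.
(* a stage [g] above the whole sequence exists; its range is closed and does not
   contain [b'] *)
have [g hg] := bdd al.
have [v cv] := cluster_exists hK (fmap_proper_filter (x \o al) eventually_filter).
have fv : r (s g) v = v.
  apply: (cluster_closed (rsk_fix_closed hK sk (s := s g)) _ cv).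
  by exists 0%N => // n _ /=; exact: fx.
have t0v : r t0 v = r t0 b.
  apply: (@cluster_closed _ _ [set v | r t0 v = r t0 b] _ _ _ cv).
    by apply: (closed_eqfun hK.2); [exact: rsk_cont sk _|move=> ?; exact: cvg_cst].
  by exists 0%N => // n _ /=; exact: ucx.
have qv : q v = q c.
  apply: (cvg_cluster_eq hL.2 mt).
  have -> : m = q \o (x \o al) by apply/funext => n /=; rewrite hal.
  exact: (cluster_map (qc v) cv).
have [vc|vb] := fibre c b' v (or_intror (conj erefl erefl)) qv.
  by apply: nc; rewrite -t0v vc rc.
by apply: (nfb' g); rewrite -vb.
Qed.

End OutsideCore.

(** * Metrizability from countably many functions *)

(** The metric is the supremum of the [`|f n x - f n y| / n.+1]. *)
Lemma metrizable_separating (R : realType) (L : topologicalType) (A : set L)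
    (f : nat -> L -> R) :
  compact_hausdorff L -> closed A -> (forall n, continuous_unit (f n)) ->
  (forall x y, A x -> A y -> (forall n, f n x = f n y) -> x = y) ->
  metrizable R (set_type A).
Proof.
move=> hL Ac fu fsep.
pose T x y := [set `|f n x - f n y| / n.+1%:R | n in [set: nat]].
have T1 n x y : `|f n x - f n y| <= 1.
  have [_ /(_ x)] := fu n; have [_ /(_ y)] := fu n.
  by rewrite ler_norml; lra.
have Tn n x y : `|f n x - f n y| / n.+1%:R <= n.+1%:R^-1.
  by rewrite ler_piMl // invr_ge0.
have Tub x y : has_ubound (T x y).
  exists 1 => _ [n _ <-]; apply: le_trans (Tn _ _ _) _.
  by rewrite invf_le1 ?ltr0n // ler1n.
have T0 x y : T x y !=set0 by exists (`|f 0%N x - f 0%N y| / 1%:R), 0%N.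
pose D x y := sup (T x y).
have Dge n x y : `|f n x - f n y| / n.+1%:R <= D x y.
  by apply: (ub_le_sup (Tub x y)); exists n.
have D0 x y : 0 <= D x y.
  by apply: le_trans (Dge 0%N x y); rewrite divr_ge0.
have Dle x y e : (forall n, `|f n x - f n y| / n.+1%:R <= e) -> D x y <= e.
  by move=> h; apply: ge_sup => // _ [n _ <-].
have fD n x y e : D x y <= e -> `|f n x - f n y| <= e * n.+1%:R.
  by move=> h; rewrite -ler_pdivrMr ?ltr0n //; exact: le_trans (Dge _ _ _) h.
exists (fun x y => D (val x) (val y)); split=> // [x y|x y|x y z|x].
- split=> [e|->].
    apply/val_inj/fsep; [exact: set_valP|exact: set_valP|] => n.
    apply/eqP; rewrite -subr_eq0 -normr_le0.
    by have := fD n (val x) (val y) 0; rewrite e mul0r; exact.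
  apply/eqP; rewrite eq_le D0 andbT; apply: Dle => n.
  by rewrite subrr normr0 mul0r.
- by congr sup; apply/seteqP; split=> _ [n _ <-]; exists n => //; rewrite distrC.
- apply: Dle => n; apply: le_trans (lerD (Dge n _ (val y)) (Dge n _ _)).
  rewrite -mulrDl ler_pM2r ?invr_gt0 ?ltr0n //.
  exact: ler_distD.
apply/seteqP; split=> U.
  case=> _ [[V Vo <-] Vx VU]; apply: contrapT => nU.
  pose F := filter_from [set e : R | 0 < e]
    (fun e => A `&` ~` V `&` [set y | D (val x) y <= e]).
  have FF : ProperFilter F.
    apply: filter_from_proper => [|e e0]; last first.
      apply: contrapT => h; apply: nU; exists e => // y xy; apply: VU => /=.
      apply: contrapT => nVy; apply: h; exists (val y); split; last exact: ltW.
      by split=> //; exact: set_valP.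
    apply: filter_from_filter; first by exists 1; exact: ltr01.
    move=> e e' e0 e'0; exists (Num.min e e'); first by rewrite /= lt_min e0.
    by move=> y [AV /=]; rewrite le_min => /andP[].
  have [y cy] := cluster_exists hL FF.
  have [Ay nVy] : (A `&` ~` V) y.
    apply: (cluster_closed _ _ cy); last by exists 1 => [|? []] //; exact: ltr01.
    by apply: closedI => //; exact: open_closedC.
  apply: nVy; suff -> : y = val x by [].
  apply: fsep => // [|n]; first exact: set_valP.
  apply/eqP; rewrite eq_sym -subr_eq0 -normr_le0; apply/ler_addgt0Pl => e e0; rewrite addr0.
  apply: (@cluster_closed _ _ [set y | `|f n (val x) - f n y| <= e] _ _ _ cy).
    apply: (@preimage_closed _ _ (fun y => `|f n (val x) - f n y|) [set z | z <= e]).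
      move=> z _; apply: cvg_norm; apply: cvgB; first exact: cvg_cst.
      by have [+ _] := fu n; exact.
    exact: closed_le.
  exists (e / n.+1%:R); first by rewrite /= divr_gt0.
  by move=> z [_ /= /(fD n)]; rewrite divfK.
move=> [e /= e0 eU].
have e20 : 0 < e / 2 by rewrite divr_gt0.
have [N _ hN] := near_infty_natSinv_lt (PosNum e20).
have near_N M : nbhs (val x) [set y | forall n, (n < M)%N -> `|f n (val x) - f n y| < e / 2].
  elim: M => [|M IH]; first by apply: (@filterE _ (nbhs (val x))).
  have fM : nbhs (val x) [set y | `|f M (val x) - f M y| < e / 2].
    have [/(_ (val x)) + _] := fu M.
    by move=> /cvgrPdist_lt /(_ _ e20).
  apply: filterS (filterI IH fM) => y [h hM] n; rewrite ltnS leq_eqVlt.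
  by move=> /orP[/eqP ->//|]; exact: h.
have : nbhs x (val @^-1` [set y | forall n, (n < N)%N -> `|f n (val x) - f n y| < e / 2]).
  by apply: (@initial_continuous _ _ (val : set_type A -> L)); exact: near_N.
apply: filterS => y h; apply: eU => /=.
apply: (@le_lt_trans _ _ (e / 2)); last by rewrite ltr_pdivrMr // ltr_pMr // ltr1n.
apply: Dle => n; have [nN|Nn] := ltnP n N.
  apply: le_trans (ltW (h n nN)); rewrite ler_piMr // invf_le1 ?ltr0n // ler1n //.
by apply: le_trans (Tn _ _ _) _; apply/ltW/(hN n).
Qed.

(** * Continuous images of Corson compact spaces *)

Section SubsetPoset.
Variables (T : Type) (P : set (set T)).
Definition subset_poset := set_type P.
HB.instance Definition _ := Choice.on subset_poset.
HB.instance Definition _ := SubType.on subset_poset.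
HB.instance Definition _ :=
  [SubChoice_isSubPOrder of subset_poset by <: with set_display].

Lemma subset_posetE (A B : subset_poset) : (A <= B)%O = (val A `<=` val B) :> Prop.
Proof. by rewrite -subsetEset. Qed.

End SubsetPoset.

Section CorsonImage.
Variables (R : realType) (K L : topologicalType) (kappa : Type).
Variables (h : K -> {ptws kappa -> R}) (q : K -> L).
Hypotheses (hK : compact_hausdorff K) (hL : compact_hausdorff L).
Hypotheses (hinj : injective h) (hc : forall g, continuous (fun x => h x g)).
Hypothesis hsupp : forall x, countable [set g | h x g != 0].
Hypotheses (qc : continuous q) (qs : set_surj [set: K] [set: L] q).

(** Compactness of the kernel of [q]. *)
Lemma cluster_pair (k k' : nat -> K) : (forall n, q (k n) = q (k' n)) ->
  exists p : K * K, cluster ((fun n => (k n, k' n)) @ \oo) p /\ q p.1 = q p.2.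
Proof.
move=> e.
have FT : ((fun n => (k n, k' n)) @ \oo) ([set: K] `*` [set: K]).
  exact: (@filterE _ \oo).
have [p [_ cp]] := compact_setX hK.1 hK.1 _ FT.
exists p; split=> //; apply: (@cluster_closed _ _ [set p | q p.1 = q p.2] _ _ _ cp).
  apply: (closed_eqfun hL.2) => z; apply: continuous_comp; try exact: qc.
    exact: cvg_fst.
  exact: cvg_snd.
by apply: (@filterE _ \oo) => n; exact: e.
Qed.

Lemma cluster_pair_closed (k k' : nat -> K) p (C : set K) N :
  cluster ((fun n => (k n, k' n)) @ \oo) p -> closed C ->
  ((forall n, (N <= n)%N -> C (k n)) -> C p.1) /\
  ((forall n, (N <= n)%N -> C (k' n)) -> C p.2).
Proof.
move=> cp Cc; split=> Ck.
  apply: (@cluster_closed _ _ (fst @^-1` C) _ _ _ cp).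
    by apply: preimage_closed => // z _; exact: cvg_fst.
  by exists N => // n; exact: Ck.
apply: (@cluster_closed _ _ (snd @^-1` C) _ _ _ cp).
  by apply: preimage_closed => // z _; exact: cvg_snd.
by exists N => // n; exact: Ck.
Qed.

Lemma closed_coord g a : closed [set x | h x g = a].
Proof.
by apply: (closed_eqfun (@Rhausdorff R)); [exact: hc|move=> z; exact: cvg_cst].
Qed.

Section Boxes.
Variable e : nat -> option kappa.

Let phi i x := if e i is Some g then h x g else 0.

Let phi_cont i : continuous (phi i).
Proof. by rewrite /phi; case: (e i) => [g|]; [exact: hc|move=> x; exact: cvg_cst]. Qed.

(** Closed boxes in the first [n] coordinates of the enumeration [e], with side
2/(n+1) and centre in the lattice of mesh 1/(n+1). For each [n] they form a
countable family. *)
Definition box (n : nat) (l : seq int) : set K :=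
  [set x | forall i, (i < n)%N -> `|n.+1%:R * phi i x - (nth 0 l i)%:~R| <= 1].

Definition box_code (n : nat) (x : K) : seq int :=
  [seq Num.floor (n.+1%:R * phi i x) | i <- iota 0 n].

Lemma box_codeP n x : box n (box_code n x) x.
Proof.
move=> i ni; rewrite (nth_map 0%N) ?size_iota // nth_iota // add0n.
have := floor_itv (n.+1%:R * phi i x); rewrite intrD ler_norml => /andP[]; lra.
Qed.

Lemma closed_box n l : closed (box n l).
Proof.
rewrite (_ : box n l = \bigcap_(i in [set i | (i < n)%N])
    [set x | `|n.+1%:R * phi i x - (nth 0 l i)%:~R| <= 1]); last first.
  by apply/seteqP; split=> x hx i; exact: hx.
apply: closed_bigI => i _.
apply: (@preimage_closed _ _ (fun x => `|n.+1%:R * phi i x - (nth 0 l i)%:~R|)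
  [set z | z <= 1]); last exact: closed_le.
move=> z _; apply: cvg_norm; apply: cvgB; last exact: cvg_cst.
by apply: cvgM; [exact: cvg_cst|exact: phi_cont].
Qed.

(** A point in the same box of rank [n] as [x], for each [n], tends to [x] in
every coordinate that is enumerated. *)
Lemma box_limit (x x' : K) (k k' : nat -> K) p :
  (forall n, box n (box_code n x) (k n)) ->
  (forall n, box n (box_code n x') (k' n)) ->
  cluster ((fun n => (k n, k' n)) @ \oo) p ->
  forall i g, e i = Some g -> h p.1 g = h x g /\ h p.2 g = h x' g.
Proof.
move=> kx kx' cp i g eig.
have ball y y' n : (i < n)%N -> box n (box_code n y) y' ->
    `|h y g - h y' g| <= 2 / n.+1%:R.
  move=> ni /(_ _ ni) b'; have := box_codeP y ni; move: b'.
  rewrite /phi eig; set l := nth _ _ _; set a := h y g; set c := h y' g.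
  rewrite ler_pdivlMr ?ltr0n // -[X in _ * X <= _]gtr0_norm ?ltr0n // -normrM.
  rewrite !ler_norml => /andP[h1 h2] /andP[h3 h4].
  by rewrite mulrBl ![_ * n.+1%:R]mulrC; apply/andP; split; lra.
have lim y y' : (forall N : nat, (i < N)%N -> `|h y g - h y' g| <= 2 / N.+1%:R) ->
    h y' g = h y g.
  move=> H; apply/eqP; rewrite eq_sym -subr_eq0 -normr_le0.
  apply/ler_addgt0Pl => d d0; rewrite addr0.
  have d20 : 0 < d / 2 by rewrite divr_gt0.
  have [N _ hN] := near_infty_natSinv_lt (PosNum d20).
  apply: le_trans (H (maxn N i.+1) (leq_maxr _ _)) _.
  have : (maxn N i.+1).+1%:R^-1 < d / 2 := hN _ (leq_maxl N i.+1).
  by rewrite ltr_pdivlMr // mulrC => /ltW.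
have cb y N : closed [set y' | `|h y g - h y' g| <= 2 / N.+1%:R].
  apply: (@preimage_closed _ _ (fun y' => `|h y g - h y' g|) [set z | z <= _]);
    last exact: closed_le.
  by move=> z _; apply: cvg_norm; apply: cvgB; [exact: cvg_cst|exact: hc].
have shrink y y' n N : (i < N)%N -> (N <= n)%N -> box n (box_code n y) y' ->
    `|h y g - h y' g| <= 2 / N.+1%:R.
  move=> iN Nn /(ball _ _ _ (leq_trans iN Nn)) /le_trans; apply.
  by rewrite ler_pM2l // lef_pV2 ?posrE ?ltr0n // ler_nat.
split; apply: lim => N iN.
  apply: (cluster_pair_closed N cp (cb x N)).1 => n Nn; exact: shrink (kx n).
apply: (cluster_pair_closed N cp (cb x' N)).2 => n Nn; exact: shrink (kx' n).
Qed.

End Boxes.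

(** With [A = B] this says that [k] is the restriction of [x] to [A], extended
by zero. *)
Definition matches (A B : set kappa) (x k : K) :=
  (forall g, A g -> h k g = h x g) /\ (forall g, ~ B g -> h k g = 0).

(** For each pair of boxes over [A] whose images under [q] meet, select one pair
of points witnessing it; [B] adds the supports of the selected points to [A].
Given [x] and [x'] with [q x = q x'], the points selected for smaller and
smaller boxes around them accumulate at the required [k] and [k']. *)
Lemma closing_off (A : set kappa) : countable A -> exists B, [/\ countable B,
  A `<=` B & forall x x', q x = q x' -> exists k k',
    [/\ matches A B x k, matches A B x' k' & q k = q k']].
Proof.
move=> cA; have [e eA] := countable_enum_option cA.
have /choice[pick hpick] (c : nat * seq int * seq int) : exists o : option (K * K),
    (exists k k', [/\ box e c.1.1 c.1.2 k, box e c.1.1 c.2 k' & q k = q k']) ->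
    exists k k', [/\ o = Some (k, k'), box e c.1.1 c.1.2 k,
      box e c.1.1 c.2 k' & q k = q k'].
  have [[k [k' hk]]|nk] := pselect (exists k k', [/\ box e c.1.1 c.1.2 k,
      box e c.1.1 c.2 k' & q k = q k']); last by exists None.
  by exists (Some (k, k')) => _; exists k, k'; case: hk.
pose S c := if pick c is Some (k, k') then
  [set g | h k g != 0] `|` [set g | h k' g != 0] else set0.
exists (A `|` \bigcup_c S c); split; first 1 last.
- by move=> g Ag; left.
- move=> x x' xx'.
  have /choice[kk hkk] n : exists p : K * K,
      [/\ box e n (box_code e n x) p.1, box e n (box_code e n x') p.2,
       q p.1 = q p.2 & forall g, ~ (A `|` \bigcup_c S c) g ->
         h p.1 g = 0 /\ h p.2 g = 0].
    have [|k [k' [ek bk bk' qk]]] := hpick (n, box_code e n x, box_code e n x').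
      by exists x, x'; split=> //; exact: box_codeP.
    exists (k, k'); split=> // g ng; split; apply/eqP; apply: contrapT => /negP nk;
      apply: ng; right; exists (n, box_code e n x, box_code e n x') => //;
      rewrite /S ek; [by left|by right].
  have hq n : q (kk n).1 = q (kk n).2 by case: (hkk n).
  have hb n : box e n (box_code e n x) (kk n).1 by case: (hkk n).
  have hb' n : box e n (box_code e n x') (kk n).2 by case: (hkk n).
  have [p [cp qp]] := cluster_pair (k := fun n => (kk n).1) (k' := fun n => (kk n).2) hq.
  have lim := box_limit hb hb' cp.
  exists p.1, p.2; split=> //; split=> [g /eA[i ei]|g ng].
  + by have [] := lim _ _ ei.
  + apply: (cluster_pair_closed 0 cp (closed_coord (g := g) (a := 0))).1 => n _.
    by have [_ _ _ /(_ _ ng)[]] := hkk n.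
  + by have [] := lim _ _ ei.
  + apply: (cluster_pair_closed 0 cp (closed_coord (g := g) (a := 0))).2 => n _.
    by have [_ _ _ /(_ _ ng)[]] := hkk n.
- apply: countable_setU => //; apply: bigcup_countable => // c _.
  rewrite /S; case: (pick c) => [[k k']|]; last exact: countable0.
  exact: countable_setU.
Qed.

(** The maps [x |-> k] so described are coordinate restrictions that are
compatible with [q]. *)
Definition admissible : set (set kappa) := [set A | countable A /\
  forall x x', q x = q x' -> exists k k',
    [/\ matches A A x k, matches A A x' k' & q k = q k']].

Lemma admissible_bigcup (A : nat -> set kappa) :
  (forall m, countable (A m)) -> (forall m, A m `<=` A m.+1) ->
  (forall m x x', q x = q x' -> exists k k',
    [/\ matches (A m) (\bigcup_n A n) x k,
        matches (A m) (\bigcup_n A n) x' k' & q k = q k']) ->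
  admissible (\bigcup_n A n).
Proof.
move=> cA A1 hA; split; first exact: bigcup_countable.
move=> x x' xx'.
have Am i j : (i <= j)%N -> A i `<=` A j.
  elim: j => [|j IH]; first by rewrite leqn0 => /eqP ->.
  by rewrite leq_eqVlt => /orP[/eqP ->//|/IH h' g /h' /A1].
have /choice[kk hkk] m : exists p : K * K,
    [/\ matches (A m) (\bigcup_n A n) x p.1,
        matches (A m) (\bigcup_n A n) x' p.2 & q p.1 = q p.2].
  by have [k [k' ?]] := hA m x x' xx'; exists (k, k').
have hq n : q (kk n).1 = q (kk n).2 by case: (hkk n).
have [p [cp qp]] := cluster_pair (k := fun n => (kk n).1) (k' := fun n => (kk n).2) hq.
exists p.1, p.2; split=> //; split=> [g [m _ Ag]|g ng].
- apply: (cluster_pair_closed m cp (closed_coord (g := g) (a := h x g))).1 => n mn.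
  by have [[a _] _ _] := hkk n; apply: a; exact: Am Ag.
- apply: (cluster_pair_closed 0 cp (closed_coord (g := g) (a := 0))).1 => n _.
  by have [[_ a] _ _] := hkk n; exact: a.
- apply: (cluster_pair_closed m cp (closed_coord (g := g) (a := h x' g))).2 => n mn.
  by have [_ [a _] _] := hkk n; apply: a; exact: Am Ag.
- apply: (cluster_pair_closed 0 cp (closed_coord (g := g) (a := 0))).2 => n _.
  by have [_ [_ a] _] := hkk n; exact: a.
Qed.

Lemma admissible_cofinal (A : set kappa) : countable A ->
  exists B, admissible B /\ A `<=` B.
Proof.
move=> cA.
have /choice[cl hcl] (C : set kappa) : exists B, countable C -> [/\ countable B,
    C `<=` B & forall x x', q x = q x' -> exists k k',
      [/\ matches C B x k, matches C B x' k' & q k = q k']].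
  have [/closing_off[B hB]|nC] := pselect (countable C); first by exists B.
  by exists C => /nC.
pose S n := iter n cl A.
have cS n : countable (S n) by elim: n => //= n /hcl[].
exists (\bigcup_n S n); split; last by move=> g Ag; exists 0%N.
apply: admissible_bigcup => // m; first by have [] := hcl _ (cS m).
move=> x x' xx'; have [_ _ /(_ _ _ xx')[k [k' [[a b] [a' b'] e]]]] := hcl _ (cS m).
exists k, k'; split=> //; split=> // g ng.
  by apply: b => Sg; apply: ng; exists m.+1.
by apply: b' => Sg; apply: ng; exists m.+1.
Qed.

Lemma matches_unique A x k k' : matches A A x k -> matches A A x k' -> k = k'.
Proof.
move=> [a b] [a' b']; apply: hinj; apply/funext => g.
have [Ag|nA] := pselect (A g); first by rewrite a // a'.
by rewrite b // b'.
Qed.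

Lemma matches_exists A : admissible A -> forall x, exists k, matches A A x k.
Proof. by move=> [_ hA] x; have [k [_ [? _ _]]] := hA x x erefl; exists k. Qed.

(** The retraction of [L] attached to [A] sends [q x] to [q k], [k] being the
restriction of [x] to [A]. Its range is metrizable: Urysohn functions that
separate the images of boxes over [A], whenever these are disjoint, separate
the points of the range, since two points not separated come from points of
[K] with the same coordinates in [A] as two points identified by [q]. *)
Lemma corson_image_skeleton : has_r_skeleton R L.
Proof.
pose G := subset_poset admissible.
have Gadm (A : G) : admissible (val A) by exact: set_valP A.
have /choice[rK hrK] (A : G) : exists r, forall x, matches (val A) (val A) x (r x).
  by have /choice[r hr] := matches_exists (Gadm A); exists r.
have rKq (A : G) x x' : q x = q x' -> q (rK A x) = q (rK A x').
  move=> /(Gadm A).2[k [k' [mk mk' e]]].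
  by rewrite -(matches_unique mk (hrK A x)) -(matches_unique mk' (hrK A x')).
have hrKE (A : G) x g : h (rK A x) g = if `[< val A g >] then h x g else 0.
  by have [a b] := hrK A x; case: asboolP => [/a|/b].
have rK_cont A : continuous (rK A).
  move=> x; apply: (cluster_unique_cvg hK) => y cy.
  apply: hinj; apply/funext => g.
  have hgc : {for x, continuous (fun z => h (rK A z) g)}.
    rewrite (_ : (fun z => _) = (fun z => if `[< val A g >] then h z g else 0));
      last by apply/funext => z; exact: hrKE.
    by case: asboolP => _; [exact: hc|exact: cvg_cst].
  exact: (cvg_cluster_eq (@Rhausdorff R) hgc (cluster_map (@hc g y) cy)).
have rKK (A B : G) x : (A <= B)%O -> rK A (rK B x) = rK A x /\ rK B (rK A x) = rK A x.
  rewrite subset_posetE => AB; split; apply: hinj; apply/funext => g; rewrite !hrKE.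
    by case: asboolP => // /AB; case: asboolP.
  by case: asboolP => // nB; case: asboolP => // /AB.
have /choice[sec hsec] (y : L) : exists x, q x = y.
  by have [x _ xy] := qs (I : setT y); exists x.
pose r (A : G) (y : L) := q (rK A (sec y)).
have rq A x : r A (q x) = q (rK A x) by apply: rKq; rewrite hsec.
have rE A y : r A y = q (rK A (sec y)) by [].
exists set_display, G, r; split.
- split.
    have [A [Aadm _]] := admissible_cofinal (countable0 kappa).
    exact: (inhabits (SigSub (mem_set Aadm))).
  move=> A B; have [C [Cadm ABC]] :=
    admissible_cofinal (countable_setU (Gadm A).1 (Gadm B).1).
  exists (SigSub (mem_set Cadm)); rewrite !subset_posetE /=.
  by split=> g ?; apply: ABC; [left|right].
- move=> A; split=> [|y].
    apply/continuous_closedP => C Cc.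
    rewrite (_ : _ @^-1` _ = q @` ((q \o rK A) @^-1` C)).
      apply: (compact_closed_map hK.1 hL.2 qc); apply: preimage_closed => // x _.
      by apply: continuous_comp; [exact: rK_cont|exact: qc].
    apply/seteqP; split=> [y Cy|_ [x Cx <-]]; last by rewrite /preimage /= rq.
    by exists (sec y).
  by rewrite [r A y]rE rq (rKK A A (sec y) (lexx A)).1.
- move=> y; have [A [Aadm Asupp]] := admissible_cofinal (hsupp (sec y)).
  move=> U /nbhs_singleton Uy; exists (SigSub (mem_set Aadm)) => // B.
  rewrite /= subset_posetE /= => AB.
  suff : r B y = y by move=> e; rewrite /= e.
  rewrite rE (_ : rK B (sec y) = sec y) //.
  apply: hinj; apply/funext => g; rewrite hrKE; case: asboolP => // nB.
  by apply/esym/eqP; apply: contrapT => /negP nz; apply: nB; apply: AB; exact: Asupp.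
- move=> A; have [e eA] := countable_enum_option (Gadm A).1.
  have /choice[F hF] (c : nat * seq int * seq int) : exists f : L -> R,
      continuous_unit f /\
      (q @` box e c.1.1 c.1.2 `&` q @` box e c.1.1 c.2 = set0 ->
       (forall y, (q @` box e c.1.1 c.1.2) y -> f y = 0) /\
       (forall y, (q @` box e c.1.1 c.2) y -> f y = 1)).
    have [disj|ndisj] := pselect (q @` box e c.1.1 c.1.2 `&` q @` box e c.1.1 c.2 = set0);
      last first.
      exists (fun=> 0); split=> //; split=> [x|x]; first exact: cvg_cst.
      by rewrite lexx ler01.
    have /(@normal_separatorP R) := compact_normal hL.2 hL.1.
    move=> /(_ _ _ (compact_closed_map hK.1 hL.2 qc (@closed_box e _ _))
      (compact_closed_map hK.1 hL.2 qc (@closed_box e _ _)) disj) /(@uniform_separatorP _ R).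
    move=> [f [fc f01 f0 f1]]; exists f; split=> [|_]; last first.
      by split=> y hy; [apply: f0|apply: f1]; exists y.
    by split=> // y; have := f01 _ (ex_intro2 _ _ y I erefl); rewrite /= in_itv.
  pose f n := if unpickle n is Some c then F c else fun=> 0.
  apply: (@metrizable_separating R L (range (r A)) f hL).
  + have -> : range (r A) = q @` (range (rK A)).
      apply/seteqP; split=> [_ [y _ <-]|_ [_ [x _ <-] <-]].
        by exists (rK A (sec y)) => //; exists (sec y).
      by exists (q x) => //; rewrite rq.
    apply: (compact_closed_map hK.1 hL.2 qc); apply: compact_closed hK.2 _.
    apply: continuous_compact hK.1; exact: continuous_subspaceT.
  + move=> n; rewrite /f; case: unpickle => [c|]; first by case: (hF c).
    by split=> [x|x]; [exact: cvg_cst|rewrite lexx ler01].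
  + move=> _ _ [y _ <-] [y' _ <-] ef; rewrite !rE.
    set x := rK A (sec y); set x' := rK A (sec y').
    have /choice[kk hkk] n : exists p : K * K,
        [/\ box e n (box_code e n x) p.1, box e n (box_code e n x') p.2 & q p.1 = q p.2].
      apply: contrapT => np.
      have [|f0 f1] := (hF (n, box_code e n x, box_code e n x')).2.
        apply/seteqP; split=> // _ [[k bk <-] [k' bk' e']]; apply: np.
        by exists (k, k').
      have := ef (pickle (n, box_code e n x, box_code e n x')).
      rewrite /f pickleK f0; last by exists x => //; exact: box_codeP.
      rewrite f1; last by exists x' => //; exact: box_codeP.
      by move/eqP; rewrite eq_sym oner_eq0.
    have hq n : q (kk n).1 = q (kk n).2 by case: (hkk n).
    have hb n : box e n (box_code e n x) (kk n).1 by case: (hkk n).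
    have hb' n : box e n (box_code e n x') (kk n).2 by case: (hkk n).
    have [p [cp qp]] := cluster_pair (k := fun n => (kk n).1)
      (k' := fun n => (kk n).2) hq.
    have lim := box_limit hb hb' cp.
    have -> : x = rK A p.1.
      apply: hinj; apply/funext => g; rewrite !hrKE.
      case: asboolP => // Ag; have [i /lim[-> _]] := (eA g).1 Ag.
      by rewrite hrKE asboolT.
    have -> : x' = rK A p.2.
      apply: hinj; apply/funext => g; rewrite !hrKE.
      case: asboolP => // Ag; have [i /lim[_ ->]] := (eA g).1 Ag.
      by rewrite hrKE asboolT.
    exact: rKq.
- move=> A B AB; split; apply/funext => y /=; rewrite ![r _ y]rE rq.
    by rewrite (rKK A B (sec y) AB).1.
  by rewrite (rKK A B (sec y) AB).2.
- move=> A A1.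
  have AS m : val (A m) `<=` val (A m.+1).
    by have := ltW (A1 m); rewrite subset_posetE.
  have Tadm : admissible (\bigcup_n val (A n)).
    apply: admissible_bigcup => // m; first exact: (Gadm (A m)).1.
    move=> x x' /(Gadm (A m)).2[k [k' [[a b] [a' b'] e]]]; exists k, k'; split=> //.
      by split=> // g ng; apply: b => Ag; apply: ng; exists m.
    by split=> // g ng; apply: b' => Ag; apply: ng; exists m.
  pose T : G := SigSub (mem_set Tadm).
  exists T.
    split=> [_ [n _ <-]|B hB].
      by rewrite subset_posetE => g Ag; exists n.
    rewrite subset_posetE => g [n _ Ag].
    by have := hB _ (ex_intro2 _ _ n I erefl); rewrite subset_posetE; exact.
  move=> y; rewrite rE; under eq_fun do rewrite rE.
  apply: continuous_cvg; first exact: qc.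
  apply: (cluster_unique_cvg hK) => z cz; apply: hinj; apply/funext => g.
  have Am i j : (i <= j)%N -> val (A i) `<=` val (A j).
    move=> ij; rewrite -subset_posetE.
    by apply: nondecreasing_homo ij => n; exact: ltW.
  rewrite hrKE; case: asboolP => [[n _ Ag]|nT].
    apply: (cluster_closed (closed_coord (g := g) (a := h (sec y) g)) _ cz).
    exists n => // m nm; rewrite /= hrKE; case: asboolP => // [[]].
    exact: Am Ag.
  apply: (cluster_closed (closed_coord (g := g) (a := 0)) _ cz).
  exists 0%N => // m _; rewrite /= hrKE; case: asboolP => // Ag.
  by case: nT; exists m.
Qed.

End CorsonImage.

(** * The characterization *)

Theorem theorem2p2 (R : realType) (K : topologicalType)
    (hK : compact_hausdorff K) :
  corson R K <->
  (forall L : topologicalType, continuous_image K L -> has_r_skeleton R L).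
Proof.
split=> [[kappa [h [[hinj hc _] _ hS]]] L [hL [q [qc qs]]]|images].
  apply: (corson_image_skeleton hK hL hinj _ _ qc qs) => [g|x].
    exact: ptws_coord_continuous.
  by apply: hS; exists x.
have [d [G [r sk]]] : has_r_skeleton R K.
  apply: images; split=> //; exists id; split; first by move=> x; exact: cvg_id.
  by move=> x _; exists x.
apply: (full_skeleton_corson hK sk) => x; apply: contrapT => nx.
exact: (outside_core_absurd hK sk nx images).
Qed.
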